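(* Let $G$ be any graph. (i) If $G$ is tough, then every $\Omega$-compactification of $G$ coincides with $|G|_\Omega$. (ii) If $G$ is not tough but end-tough, then $G$ has a crude one-point $\Omega$-compactification $\alpha G$ such that: $\alpha G$ is the coarsest crude $\Omega$-compactification of $G$ (that is, $\alpha G\le\delta G$ for every crude $\Omega$-compactification $\delta G$ of $G$); $\alpha G$ is a quotient of every crude $\Omega$-compactification $\delta G$ of $G$ (that is, for $f\colon\delta G\ge\alpha G$ the quotient $\delta G/\{f^{-1}(\xi)\mid \xi\in\alpha G\}$ is topologically equivalent to $\alpha G$); and $\alpha G$ is not topologically equivalent to $|G|_\Theta$. (iii) If $G$ is neither tough nor end-tough, then $G$ has no $\Omega$-compactification with remainder of size at most one. Moreover, $G$ then has no coarsest $\Omega$-compactification, and the class of crude $\Omega$-compactifications of $G$ has no coarsest element either. In particular, $|G|_\Theta$ is the coarsest $\Omega$-compactification of $G$ if and only if $G$ is tough.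
   Context: Graph notation. $G=(V,E)$ is a graph, $\mathcal X$ is the set of all finite subsets of $V$, and for $X\in\mathcal X$, $\mathcal C_X$ is the set of components of $G-X$. For $\mathcal C\subseteq\mathcal C_X$ put $V[\mathcal C]=\bigcup_{C\in\mathcal C}V(C)$. A ray is a 1-way infinite path; two rays are equivalent if for every $X\in\mathcal X$ both have a tail in the same component of $G-X$; an end is an equivalence class of rays, $\Omega$ is the set of ends, and $C(X,\omega)$ is the component of $G-X$ in which all rays of the end $\omega$ have a tail. Tough. A graph is tough if deleting any finite set of vertices leaves only finitely many components. An end $\omega$ is tough if $C(X,\omega)$ is a tough graph for some $X\in\mathcal X$. $G$ is end-tough if all its ends are tough. Topology. $G$ also denotes its 1-complex, with point set $V\sqcup\bigsqcup_{e\in E}\mathring e$, where each edge $e=xy$ is a homeomorphic copy $\{x\}\sqcup\mathring e\sqcup\{y\}$ of $[0,1]$ with $\mathring e$ corresponding to $(0,1)$; points of $\mathring e$ (inner edge points) have the basic open neighbourhoods inherited from $(0,1)$, and the basic open neighbourhoods of a vertex $v$ are the unions $\bigcup_{e\in E(v)}[v,i_e)$ of half-open intervals, with $i_e\in\mathring e$ arbitrary and $E(v)$ the set of edges at $v$. For $F\subseteq E$, $\mathring F=\bigsqcup_{e\in F}\mathring e$ (this never means a topological interior). $E(X,\bigcup\mathcal C)$ is the set of edges between $X$ and $\bigcup\mathcal C$. $|G|_\Omega=G\sqcup\Omega$ has the topology generated by the open sets of $G$ and all sets $\bigcup\mathcal C\cup\mathring E(X,\bigcup\mathcal C)\cup\{\omega\in\Omega\mid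 C(X,\omega)\in\mathcal C\}$ with $X\in\mathcal X$, $\mathcal C\subseteq\mathcal C_X$. Tangles. $\vec S$ is the set of all oriented finite order separations of $G$: ordered pairs $(A,B)$ with $A\cup B=V$, $A\cap B$ finite and no edge between $A\setminus B$ and $B\setminus A$. $(A,B)\le(C,D)$ means $A\subseteq C$ and $B\supseteq D$. A star is a set $\sigma\subseteq\vec S$ such that any two distinct $(A,B),(D,C)\in\sigma$ satisfy $(A,B)\le(C,D)$; its interior is $\bigcap_{(A,B)\in\sigma}B$. An $\aleph_0$-tangle of $G$ is a set $\tau\subseteq\vec S$ containing exactly one of $(A,B),(B,A)$ for every finite order separation $\{A,B\}$, that is consistent (no two distinct $(B,A),(C,D)\in\tau$ satisfy $(A,B)<(C,D)$) and has no finite star of finite interior as a subset. $\Theta$ is the set of $\aleph_0$-tangles. Each end $\omega$ is identified with the $\aleph_0$-tangle $\tau_\omega=\{(A,B)\in\vec S\mid C(A\cap B,\omega)\subseteq G[B\setminus A]\}$, so $\Omega\subseteq\Theta$. $|G|_\Theta=G\sqcup\Theta$ has the topology generated by the open sets of $G$ and all sets $\bigcup\mathcal C\cup\mathring E(X,\bigcup\mathcal C)\cup\{\tau\in\Theta\mid (V\setminus V[\mathcal C],X\cup V[\mathcal C])\in\tau\}$ with $X\in\mathcal X$, $\mathcal C\subseteq\mathcal C_X$. Compactifications. A compactification of a space $Y$ is a pair $(K,h)$ with $K$ compact (not necessarily Hausdorff) and $h\colon Y\to K$ an embedding with dense image; its remainder is $K\setminus h[Y]$. $(K,h)\le(K',h')$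 ($(K,h)$ is coarser) if there is a continuous $f\colon K'\to K$ with $f\circ h'=h$; one writes $f\colon(K',h')\ge(K,h)$. They are topologically equivalent if some such $f$ is a homeomorphism. An element of a class of compactifications is coarsest if it is $\le$ every element of the class. An $\Omega$-compactification of $G$ is a compactification $\alpha G$ of $|G|_\Omega$ such that $\alpha G\setminus\mathring E$ is a Hausdorff compactification of $|G|_\Omega\setminus\mathring E$. $\Omega$-compactifications are always treated and compared as compactifications of $|G|_\Omega$ (so the remainder is $\alpha G\setminus|G|_\Omega$); it is one-point if $|\alpha G\setminus|G|_\Omega|=1$. $|G|_\Theta$ is an $\Omega$-compactification of $G$. A set $M$ is crude if $M\cap\mathring E=\bigcup_{v\in M\cap V}\mathring E(v)$, where $\mathring E(v)$ is the set of inner points of edges at $v$. A topological space $Y\supseteq G$ is crude if it has a basis consisting of the basic open sets of $G$ and crude sets. *)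

(* Defs.v *)
From HB Require Import structures.
From Stdlib Require Import Relation_Operators.
From mathcomp Require Import all_boot all_order all_algebra.
From mathcomp Require Import generic_quotient.
From mathcomp Require Import all_classical all_reals all_analysis.

Set Implicit Arguments.
Unset Strict Implicit.
Unset Printing Implicit Defensive.

Import Order.TTheory GRing.Theory Num.Theory.

Local Open Scope classical_set_scope.
Local Open Scope ring_scope.

(** * Graphs, components, rays and ends *)

Record graph := Graph {
  vertex :> Type;
  adj : vertex -> vertex -> Prop;
  adj_sym : forall x y, adj x y -> adj y x;
  adj_irrefl : forall x, ~ adj x x }.

Definition induced (G : graph) (A : set G) : graph :=
  @Graph A (fun x y => adj (val x) (val y))
    (fun x y => @adj_sym G (val x) (val y)) (fun x => @adj_irrefl G (val x)).

Definition linked (G : graph) (A : set G) : G -> G -> Prop :=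
  clos_refl_trans G (fun x y => [/\ A x, A y & adj x y]).

(* Components are represented by their vertex sets: a component of [G - X] is
   the subgraph of [G] induced on such a set. *)
Definition components (G : graph) (X : set G) : set (set G) :=
  [set C | exists2 x, ~ X x & C = [set y | linked (~` X) x y]].

Definition tough (G : graph) : Prop :=
  forall X : set G, finite_set X -> finite_set (components X).

Definition ray (G : graph) : Type :=
  {r : nat -> G | injective r /\ forall n, adj (r n) (r n.+1)}.

Definition has_tail_in (G : graph) (r : ray G) (C : set G) : Prop :=
  exists n, forall m, (n <= m)%N -> C (sval r m).

Definition ray_equiv (G : graph) (r s : ray G) : Prop :=
  forall X : set G, finite_set X ->
    exists C, [/\ components X C, has_tail_in r C & has_tail_in s C].

Definition ends (G : graph) : Type :=
  {w : set (ray G) | exists r, w = [set s | ray_equiv r s]}.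

(* [C(X, w)]: the union of all components of [G - X] in which every ray of [w]
   has a tail; for finite [X] there is exactly one, see [end_compP]. *)
Definition end_comp (G : graph) (X : set G) (w : ends G) : set G :=
  \bigcup_(C in [set C | components X C /\
                         forall r, sval w r -> has_tail_in r C]) C.

Definition tough_end (G : graph) (w : ends G) : Prop :=
  exists2 X : set G, finite_set X & tough (induced (end_comp X w)).

Definition end_tough (G : graph) : Prop := forall w : ends G, tough_end w.

(** * Tangles *)

Definition separations (G : graph) : set (set G * set G) :=
  [set p | [/\ p.1 `|` p.2 = setT, finite_set (p.1 `&` p.2) &
    forall x y, (p.1 `\` p.2) x -> (p.2 `\` p.1) y -> ~ adj x y]].

Definition flip (T : Type) (p : T * T) : T * T := (p.2, p.1).

Definition sep_le (T : Type) (p q : set T * set T) : Prop :=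
  p.1 `<=` q.1 /\ q.2 `<=` p.2.

Definition star (G : graph) (s : set (set G * set G)) : Prop :=
  s `<=` @separations G /\
  forall p q, s p -> s q -> p <> q -> sep_le p (flip q).

Definition star_interior (G : graph) (s : set (set G * set G)) : set G :=
  \bigcap_(p in s) p.2.

Definition aleph0_tangle (G : graph) (t : set (set G * set G)) : Prop :=
  [/\ t `<=` @separations G,
      forall p, separations p -> exists! q, t q /\ (q = p \/ q = flip p),
      forall p q, t p -> t q -> p <> q ->
        ~ (sep_le (flip p) q /\ flip p <> q) &
      forall s, s `<=` t -> star s -> finite_set s ->
        ~ finite_set (star_interior s)].

Definition tangles (G : graph) : Type :=
  {t : set (set G * set G) | aleph0_tangle t}.

Definition end_tangle_set (G : graph) (w : ends G) : set (set G * set G) :=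
  [set p | separations p /\ end_comp (p.1 `&` p.2) w `<=` p.2 `\` p.1].

Section EndTangle.
Variable G : graph.
Implicit Types (X A B C : set G) (r : ray G) (w : ends G).

Lemma linked_sym A (x y : G) : linked A x y -> linked A y x.
Proof.
elim=> [a b [? ? ab]|a|a b c _ ba _ cb].
- by apply: rt_step; split=> //; exact: adj_sym.
- exact: rt_refl.
- exact: rt_trans cb ba.
Qed.

Lemma linked_in A (x y : G) : linked A x y -> A x -> A y.
Proof. by elim=> [a b []|a|a b c _ ab _ bc /ab/bc]. Qed.

Lemma componentsE X C (y : G) : components X C -> C y ->
  ~ X y /\ C = [set z | linked (~` X) y z].
Proof.
move=> [x Xx ->] /= xy; split; first exact: linked_in xy Xx.
apply/seteqP; split=> z /= h.
  exact: rt_trans (linked_sym xy) h.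
exact: rt_trans xy h.
Qed.

Lemma components_eq X C D (y : G) :
  components X C -> components X D -> C y -> D y -> C = D.
Proof.
by move=> cC cD Cy Dy; rewrite (componentsE cC Cy).2 (componentsE cD Dy).2.
Qed.

Lemma has_tailI r A B :
  has_tail_in r A -> has_tail_in r B -> has_tail_in r (A `&` B).
Proof.
move=> [n nA] [m mB]; exists (maxn n m) => k; rewrite geq_max => /andP[nk mk].
by split; [exact: nA | exact: mB].
Qed.

Lemma has_tail_ex r A : has_tail_in r A -> A !=set0.
Proof. by move=> [n nA]; exists (sval r n); exact: nA. Qed.

Lemma has_tail_infinite r A : has_tail_in r A -> ~ finite_set A.
Proof.
case: r => r [rI radj] [/= n nA] finA.
have : finite_set [set k | (n <= k)%N].
  apply: (@sub_finite_set _ _ (r @^-1` A)); first by move=> k /= /nA.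
  by apply: finite_preimage => // x y _ _ /rI.
move=> fin; apply: infinite_nat.
rewrite (_ : setT = [set k | (n <= k)%N] `|` `I_n).
  by rewrite finite_setU; split => //; exact: finite_II.
by apply/esym/seteqP; split=> // k _ /=; case: (leqP n k); [left|right].
Qed.

Lemma ray_avoids r X : finite_set X -> has_tail_in r (~` X).
Proof.
case: r => r [rI radj] finX.
have /finite_seqP[s sE] : finite_set (r @^-1` X).
  by apply: finite_preimage => // x y _ _ /rI.
exists (\max_(k <- s) k).+1 => m /= lem Xm.
have ms : m \in s by have : [set` s] m by rewrite -sE.
by have := @leq_bigmax_seq _ s xpredT id m ms isT; rewrite leqNgt lem.
Qed.

Lemma ray_equiv_refl r : ray_equiv r r.
Proof.
move=> X /(ray_avoids r)[n nX]; pose f := sval r.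
have [_ fadj] := svalP r.
have tail : has_tail_in r [set y | linked (~` X) (f n) y].
  exists n; elim=> [|m IH]; first by rewrite leqn0 => /eqP ->; exact: rt_refl.
  rewrite leq_eqVlt => /predU1P[<-|nm]; first exact: rt_refl.
  apply: rt_trans (IH nm) _; apply: rt_step.
  by split; [exact: nX | apply: nX; exact: leqW | exact: fadj].
exists [set y | linked (~` X) (f n) y]; split=> //.
by exists (f n) => //; exact: nX.
Qed.

Lemma end_compP X w : finite_set X ->
  components X (end_comp X w) /\
  forall r, sval w r -> has_tail_in r (end_comp X w).
Proof.
move=> finX; case: w => w [r wE] /=.
have [C [cC rC _]] := @ray_equiv_refl r X finX.
have tailC s : w s -> has_tail_in s C.
  rewrite wE => /(_ X finX)[D [cD rD sD]].
  have [y [Cy Dy]] := has_tail_ex (has_tailI rC rD).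
  by rewrite (components_eq cC cD Cy Dy).
suff -> : end_comp X (exist _ w (ex_intro _ r wE)) = C by [].
apply/seteqP; split=> [y [D [cD wD] Dy]|y Cy]; last by exists C.
have /wD rD : w r by rewrite wE; exact: ray_equiv_refl.
have [z [Cz Dz]] := has_tail_ex (has_tailI rC rD).
by rewrite (components_eq cC cD Cz Dz).
Qed.

Lemma end_ray w : exists r, sval w r.
Proof.
by case: w => w [r wE]; exists r; rewrite /= wE; exact: ray_equiv_refl.
Qed.

Lemma separations_flip (p : set G * set G) :
  separations p -> separations (flip p).
Proof.
move=> [pT pF pE]; split=> /=; [by rewrite setUC | by rewrite setIC |].
by move=> x y Bx Ay /adj_sym; exact: pE.
Qed.

Lemma flipK (p : set G * set G) : flip (flip p) = p.
Proof. by case: p. Qed.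

Lemma end_tangle_tail w p r :
  end_tangle_set w p -> sval w r -> has_tail_in r (p.2 `\` p.1).
Proof.
move=> [[_ finp _] sub] wr; have [n nC] := (end_compP w finp).2 _ wr.
by exists n => m /nC; exact: sub.
Qed.

Lemma end_tangle_or w (p : set G * set G) : separations p ->
  end_tangle_set w p \/ end_tangle_set w (flip p).
Proof.
move=> sp; have [pT finp pE] := sp; pose X := p.1 `&` p.2.
have [cC _] := end_compP w finp.
have [r wr] := end_ray w.
have [x Cx] := has_tail_ex ((end_compP w finp).2 _ wr).
have [Xx CE] := componentsE cC Cx.
have side (A B : set G) (y : G) : A `|` B = setT -> A `&` B = X ->
    (forall a b, (A `\` B) a -> (B `\` A) b -> ~ adj a b) ->
    (A `\` B) x -> linked (~` X) x y -> (A `\` B) y.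
  move=> ABT ABX noE Ax xy; move: Ax.
  elim: xy => [a b [Xa Xb ab] Aa|//|a b c _ IH1 _ IH2 Aa].
    have [Ab|Bb] : (A `|` B) b by rewrite ABT.
      by split=> // Bb; apply: Xb; rewrite -ABX.
    have [Ab|nAb] := pselect (A b); first by case: Xb; rewrite -ABX.
    by case: (noE a b).
  exact/IH2/IH1.
have [Ax|Bx] : (p.1 `|` p.2) x by rewrite pT.
  right; split; first exact: separations_flip.
  rewrite /= setIC CE => y /= xy; apply: (side p.1 p.2) => //.
  by split=> // Bx; apply: Xx.
left; split=> //; rewrite CE => y /= xy.
apply: (side p.2 p.1) => //; first by rewrite setUC.
- by rewrite setIC.
- by move=> a b Ba Ab /adj_sym; exact: pE.
- by split=> // Ax; apply: Xx.
Qed.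

Lemma end_tangle_aleph0_tangle w : aleph0_tangle (end_tangle_set w).
Proof.
have [r wr] := end_ray w.
have excl p : end_tangle_set w p -> end_tangle_set w (flip p) -> False.
  move=> /end_tangle_tail/(_ wr) h1 /end_tangle_tail/(_ wr) h2.
  by have [x [[] + _ [_ +]]] := has_tail_ex (has_tailI h1 h2).
split=> [p []//|p sp|p q tp tq _ [[sub _] _]|s st _].
- have [tp|tp] := end_tangle_or w sp.
    exists p; split; first by split=> //; left.
    by move=> q [tq [->//|qE]]; case: (excl p tp); rewrite -qE.
  exists (flip p); split; first by split=> //; right.
  move=> q [tq [qE|->//]]; case: (excl (flip p) tp).
  by rewrite flipK -qE.
- have h1 := end_tangle_tail tp wr; have h2 := end_tangle_tail tq wr.
  by have [x [[Ax _] [_ Cx]]] := has_tail_ex (has_tailI h1 h2); exact/Cx/sub.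
- move=> fins; apply: (@has_tail_infinite r).
  have /finite_seqP[l sE] : finite_set s := fins.
  have lt p : p \in l -> has_tail_in r p.2.
    move=> pl; have /st/end_tangle_tail/(_ wr)[n nB] : s p by rewrite sE.
    by exists n => m /nB[].
  rewrite /star_interior sE; elim: l {sE} lt => [_|p l IH lt].
    by exists 0%N => m _ p.
  have [||n nI] := has_tailI (lt p _) (IH _); first exact: mem_head.
    by move=> q ql; apply: lt; rewrite inE ql orbT.
  exists n => m /nI[pm lm] q /=; rewrite inE => /predU1P[->//|ql].
  exact: lm.
Qed.

End EndTangle.

Definition end_tangle (G : graph) (w : ends G) : tangles G :=
  exist _ (end_tangle_set w) (end_tangle_aleph0_tangle w).

(** * The 1-complex *)

Definition edge (G : graph) : Type :=
  {e : set G | exists x y, adj x y /\ e = [set x; y]}.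

Definition edges_at (G : graph) (v : G) : set (edge G) := [set e | sval e v].

Definition edges_between (G : graph) (X Y : set G) : set (edge G) :=
  [set e | exists x y, [/\ X x, Y y & sval e = [set x; y]]].

Definition unit_itv (R : realType) : Type := {t : R | 0 < t < 1}.

Inductive graph_point (R : realType) (G : graph) : Type :=
  | Vertex of G
  | Inner of edge G & unit_itv R.
Arguments Vertex R {G} _.

(* The identification of an edge with [0, 1] requires an orientation. We fix an
   arbitrary one: [edge_src e] is the endpoint at position [0]. *)
Definition edge_src (G : graph) (e : edge G) : G := sval (cid (svalP e)).

(* For [v] an endpoint of [e], the length of the part of [e] from [v] to [t]. *)
Definition dist_from (R : realType) (G : graph) (v : G) (e : edge G)
    (t : unit_itv R) : R :=
  if `[< v = edge_src e >] then val t else 1 - val t.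

Definition inner_points (R : realType) (G : graph) (F : set (edge G)) :
    set (graph_point R G) :=
  [set p | exists e t, F e /\ p = Inner e t].

Definition open_interval (R : realType) (G : graph) (e : edge G) (a b : R) :
    set (graph_point R G) :=
  [set p | exists t, a < val t < b /\ p = Inner e t].

Definition open_star (R : realType) (G : graph) (v : G)
    (i : edge G -> unit_itv R) : set (graph_point R G) :=
  [set Vertex R v] `|`
  [set p | exists e t, [/\ edges_at v e, dist_from v e t < dist_from v e (i e)
                         & p = Inner e t]].

Definition basic_open (R : realType) (G : graph) :
    set (set (graph_point R G)) :=
  [set U | (exists e a b, U = open_interval e a b) \/
           (exists v i, U = open_star v i)].

HB.instance Definition _ (R : realType) (G : graph) :=
  gen_eqMixin (graph_point R G).
HB.instance Definition _ (R : realType) (G : graph) :=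
  gen_choiceMixin (graph_point R G).
(* Two basic open sets with a common point meet in a third one, so that
   [basic_open] is not just a subbase but a base of this topology. *)
HB.instance Definition _ (R : realType) (G : graph) :=
  @isSubBaseTopological.Build (graph_point R G) (set (graph_point R G))
    (@basic_open R G) id.

(** * The spaces |G|_Omega and |G|_Theta *)

Definition subgraph_points (R : realType) (G : graph) (C : set G) :
    set (graph_point R G) :=
  [set p | match p with Vertex v => C v | Inner e _ => sval e `<=` C end].

Arguments subgraph_points R {G} C.
Arguments inner_points R {G} F.

Definition vertices_of (G : graph) (Cs : set (set G)) : set G :=
  \bigcup_(C in Cs) C.

Definition cone (R : realType) (G : graph) (X : set G) (Cs : set (set G)) :
    set (graph_point R G) :=
  \bigcup_(C in Cs) subgraph_points R C `|`
  inner_points R (edges_between X (vertices_of Cs)).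

Arguments cone R {G} X Cs.

Definition end_space (R : realType) (G : graph) : Type :=
  (graph_point R G + ends G)%type.

Definition end_space_open (R : realType) (G : graph) :
    set (set (end_space R G)) :=
  [set O | (exists2 U : set (graph_point R G), open U & O = inl @` U) \/
    (exists X Cs, [/\ finite_set X, Cs `<=` components X &
      O = inl @` cone R X Cs `|` inr @` [set w | Cs (end_comp X w)]])].

HB.instance Definition _ (R : realType) (G : graph) :=
  gen_eqMixin (end_space R G).
HB.instance Definition _ (R : realType) (G : graph) :=
  gen_choiceMixin (end_space R G).
HB.instance Definition _ (R : realType) (G : graph) :=
  @isSubBaseTopological.Build (end_space R G) (set (end_space R G))
    (@end_space_open R G) id.

Definition tangle_space (R : realType) (G : graph) : Type :=
  (graph_point R G + tangles G)%type.

Definition tangle_space_open (R : realType) (G : graph) :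
    set (set (tangle_space R G)) :=
  [set O | (exists2 U : set (graph_point R G), open U & O = inl @` U) \/
    (exists X Cs, [/\ finite_set X, Cs `<=` components X &
      O = inl @` cone R X Cs `|`
          inr @` [set t : tangles G |
                   sval t (~` vertices_of Cs, X `|` vertices_of Cs)]])].

HB.instance Definition _ (R : realType) (G : graph) :=
  gen_eqMixin (tangle_space R G).
HB.instance Definition _ (R : realType) (G : graph) :=
  gen_choiceMixin (tangle_space R G).
HB.instance Definition _ (R : realType) (G : graph) :=
  @isSubBaseTopological.Build (tangle_space R G) (set (tangle_space R G))
    (@tangle_space_open R G) id.

(** * Compactifications *)

Definition embedding (Y K : topologicalType) (h : Y -> K) : Prop :=
  [/\ injective h, continuous h &
      forall U, open U -> exists2 W, open W & h @` U = W `&` range h].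

Definition homeomorphism (Y K : topologicalType) (f : Y -> K) : Prop :=
  continuous f /\ exists g, [/\ continuous g, cancel f g & cancel g f].

Record extension (Y : topologicalType) := Extension {
  ext_space :> topologicalType;
  ext_map : Y -> ext_space }.
Arguments ext_map {Y} _ _.

Section Compactifications.
Variable Y : topologicalType.
Implicit Types a b : extension Y.

Definition compactification a : Prop :=
  [/\ compact [set: a], embedding (ext_map a) & dense (range (ext_map a))].

Definition remainder a : set a := ~` range (ext_map a).

(* [ext_hom b a f] reads [f : b >= a]. *)
Definition ext_hom b a (f : b -> a) : Prop :=
  continuous f /\ f \o ext_map b = ext_map a.

Definition coarser a b : Prop := exists f, @ext_hom b a f.

Definition top_equivalent a b : Prop :=
  exists2 f, @ext_hom b a f & homeomorphism f.

Definition coarsest (P : extension Y -> Prop) a : Prop :=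
  P a /\ forall b, P b -> coarser a b.

End Compactifications.

Arguments remainder {Y} a.

Section FibreQuotient.
Variables (K L : topologicalType) (f : K -> L).

Definition same_fibre (x y : K) : bool := f x == f y.

Lemma same_fibre_refl : reflexive same_fibre.
Proof. by move=> x; exact: eqxx. Qed.
Lemma same_fibre_sym : symmetric same_fibre.
Proof. by move=> x y; exact: eq_sym. Qed.
Lemma same_fibre_trans : transitive same_fibre.
Proof. by move=> y x z /eqP xy /eqP yz; apply/eqP; rewrite xy. Qed.

Definition same_fibre_equiv : equiv_rel K :=
  EquivRel same_fibre same_fibre_refl same_fibre_sym same_fibre_trans.

Definition fibre_quotient : topologicalType :=
  quotient_topology {eq_quot same_fibre_equiv}%qT.

Definition fibre_pi (x : K) : fibre_quotient :=
  (\pi_({eq_quot same_fibre_equiv}) x)%qT.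

End FibreQuotient.

Definition quotient_ext (Y : topologicalType) (b : extension Y)
    (L : topologicalType) (f : b -> L) : extension Y :=
  Extension (fibre_pi f \o ext_map b).

(** * Omega-compactifications *)

Definition inner_set (R : realType) (G : graph) : set (end_space R G) :=
  inl @` inner_points R setT.

(* The restriction of [ext_map a] to the complement of the inner edge points is
   the map [h] below. *)
Definition omega_compactification (R : realType) (G : graph)
    (a : extension (end_space R G)) : Prop :=
  compactification a /\
  exists h : ~` @inner_set R G -> ~` (ext_map a @` @inner_set R G),
    [/\ forall y, val (h y) = ext_map a (val y),
        compactification (Extension h) &
        hausdorff_space (~` (ext_map a @` @inner_set R G))].

Definition one_point (Y : topologicalType) (a : extension Y) : Prop :=
  exists x, remainder a = [set x].

Definition crude_set (R : realType) (G : graph) (M : set (graph_point R G)) :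
    Prop :=
  M `&` inner_points R setT =
  \bigcup_(v in [set v | M (Vertex R v)]) inner_points R (edges_at v).

Definition crude (R : realType) (G : graph) (a : extension (end_space R G)) :
    Prop :=
  let i := fun p : graph_point R G => ext_map a (inl p) in
  exists2 B : set (set a), (forall M, B M -> crude_set (i @^-1` M)) &
    basis ([set i @` U | U in @basic_open R G] `|` B).

Definition crude_omega (R : realType) (G : graph)
    (a : extension (end_space R G)) : Prop :=
  omega_compactification a /\ crude a.

Definition tangle_map (R : realType) (G : graph) (p : end_space R G) :
    tangle_space R G :=
  match p with inl x => inl x | inr w => inr (end_tangle w) end.

Definition tangle_ext (R : realType) (G : graph) : extension (end_space R G) :=
  Extension (@tangle_map R G).

(* Main.v *)
Require Import Defs.
From HB Require Import structures.
From Stdlib Require Import Relation_Operators Operators_Properties.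
From mathcomp Require Import all_boot all_order all_algebra.
From mathcomp Require Import generic_quotient.
From mathcomp Require Import all_classical all_reals all_analysis.

(** The skeleton V + Omega of |G|_Omega is Hausdorff, and for a union A of
    components of some G - X the part of it spanned by A is compact iff A is
    tough: an ultrafilter there that contains no vertex selects a component of
    every G - X, hence is a direction, and directions are ends. So for tough G the
    image of the skeleton in an Omega-compactification is compact and dense, and
    nothing is added. If G is end-tough, the skeleton is locally compact and its
    Alexandroff compactification, with crude neighbourhoods of the point at infinity,
    is the coarsest one. If an end is not tough, the skeleton is not locally compact,
    so at least two points are added, and identifying two of them gives a strictly
    coarser Omega-compactification. *)

Set Implicit Arguments.
Unset Strict Implicit.
Unset Printing Implicit Defensive.

Import Order.TTheory GRing.Theory Num.Theory.

Local Open Scope classical_set_scope.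

(** * Components and ends *)

Section Components.
Variable G : graph.
Implicit Types (X Y A B C D W : set G) (r : ray G) (w : ends G).

(** A vertex that dominates an end cannot be separated from it in the whole space, since every basic
    neighbourhood of the end contains entire edges at that vertex. Hausdorff arguments are therefore
    confined to the skeleton, and the edges are carried along by crudeness: a crude set contains an
    inner edge point exactly when it contains an endpoint of that edge. This is also what makes
    crude compactifications comparable in the end-tough case: a crude neighbourhood of a remainder
    point that avoids a compact set of vertices and ends is controlled on the edges as well, so
    collapsing the remainder is continuous. If infinitely many components are left by a finite set,
    every free ultrafilter on them yields a tangle that is no end. Two such tangles already tell the
    tangle space from a one-point compactification. Finally, two maps of compactifications agree on
    the dense image of the vertices and ends, hence on the Hausdorff skeleton; so an identification
    of two remainder points can never be undone. *)

Lemma linked_sub A B (x y : G) : A `<=` B -> linked A x y -> linked B x y.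
Proof.
move=> AB; elim=> [a b [Aa Ab ab]|a|a b c _ ab _ bc].
- by apply: rt_step; split=> //; exact: AB.
- exact: rt_refl.
- exact: rt_trans ab bc.
Qed.

Lemma linked_class A (x y : G) :
  linked A x y -> linked [set z | linked A x z] x y.
Proof.
move/clos_rt_rtn1_iff; elim=> [|a b [Aa Ab ab] /clos_rt_rtn1_iff xa IH].
  exact: rt_refl.
apply: rt_trans IH (rt_step _ _ _ _ _); split=> //=.
by apply: rt_trans xa _; exact: rt_step.
Qed.

Lemma component_disjoint X C (x : G) : components X C -> C x -> ~ X x.
Proof. by move=> cC /(componentsE cC)[]. Qed.

Lemma component_ex X C : components X C -> C !=set0.
Proof. by move=> [x Xx ->]; exists x; exact: rt_refl. Qed.

Lemma component_adj X C (x y : G) :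
  components X C -> C x -> adj x y -> ~ X y -> C y.
Proof.
move=> cC Cx xy Xy; have [Xx ->] := componentsE cC Cx.
by apply: rt_step.
Qed.

Lemma component_linked X C (x y : G) :
  components X C -> C x -> C y -> linked C x y.
Proof.
move=> cC Cx; have [Xx CE] := componentsE cC Cx.
by rewrite {1 2}CE => /linked_class.
Qed.

Lemma mem_component X (x : G) :
  ~ X x -> exists2 C, components X C & C x.
Proof.
by move=> Xx; exists [set y | linked (~` X) x y]; [exists x|exact: rt_refl].
Qed.

Lemma component_sub X Z C D (y : G) : components X C -> C `&` Z = set0 ->
  components Z D -> C y -> D y -> C `<=` D.
Proof.
move=> cC CZ cD Cy Dy z Cz; have [_ ->] := componentsE cD Dy.
apply: linked_sub (component_linked cC Cy Cz) => t Ct Zt.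
by have : (C `&` Z) t by []; rewrite CZ.
Qed.

Lemma component_mono X Y C D (y : G) : X `<=` Y ->
  components X C -> components Y D -> C y -> D y -> D `<=` C.
Proof.
move=> XY cC cD Cy Dy; apply: (component_sub cD _ cC Dy Cy).
by apply/seteqP; split=> // t [/(component_disjoint cD) + /XY].
Qed.

Lemma end_comp_component X w : finite_set X -> components X (end_comp X w).
Proof. by move=> /(end_compP w)[]. Qed.

Lemma end_comp_eq X w r C : finite_set X -> sval w r ->
  components X C -> has_tail_in r C -> end_comp X w = C.
Proof.
move=> finX wr cC rC; have [cE /(_ _ wr) rE] := end_compP w finX.
have [y [Cy Ey]] := has_tail_ex (has_tailI rC rE).
exact: components_eq cE cC Ey Cy.
Qed.

Lemma end_comp_mono X Y w : finite_set Y -> X `<=` Y ->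
  end_comp Y w `<=` end_comp X w.
Proof.
move=> finY XY; have finX := sub_finite_set XY finY.
have [r wr] := end_ray w.
have [cX /(_ _ wr) rX] := end_compP w finX.
have [cY /(_ _ wr) rY] := end_compP w finY.
have [y [Xy Yy]] := has_tail_ex (has_tailI rX rY).
exact: component_mono XY cX cY Xy Yy.
Qed.

Lemma ends_eq (w w' : ends G) :
  (forall X, finite_set X -> end_comp X w = end_comp X w') -> w = w'.
Proof.
move=> ww'.
suff h (u v : ends G) : (forall X, finite_set X -> end_comp X u = end_comp X v) ->
    sval u `<=` sval v.
  have E : sval w = sval w'.
    by apply/seteqP; split; apply: h => // X finX; rewrite ww'.
  by case: w w' E {ww'} => w pw [w' pw'] /=; exact: eq_exist.
move=> uv s us; have [r vr] := end_ray v.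
case: v uv vr => v [r0 vE] /= uv vr; rewrite vE => X finX.
have [cu /(_ _ us) su] := end_compP u finX.
have r0v : v r0 by rewrite vE; exact: ray_equiv_refl.
exists (end_comp X u); split=> //.
by rewrite uv //; apply: (end_compP _ finX).2.
Qed.

Lemma ray_end r : exists w : ends G, sval w r.
Proof.
by exists (exist _ [set s | ray_equiv r s] (ex_intro _ r erefl)); exact: ray_equiv_refl.
Qed.

End Components.

(** * Directions are ends *)

Section Directions.
Variable G : graph.
Implicit Types (X Y A B C D W : set G) (r : ray G) (w : ends G).

Local Notation T := {classic G}.

Definition adjb : rel T := fun x y => `[< @adj G x y >].

(** A walk is shortened to a path and then cut at its first vertex in [K]. The cut makes the path
    touch [K] only at its end; this keeps successive pieces disjoint when they are strung together
    into a ray. *)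
Lemma simple_path W K (x y : G) : linked W x y -> W x -> ~ K x -> K y ->
  exists s : seq T, [/\ s != [::], path adjb x s, uniq ((x : T) :: s),
    forall z, z \in s -> W z &
    K (last x s) /\ forall z, z \in s -> K z -> z = last x s].
Proof.
move=> xy Wx Kx Ky.
have [p [pp pW pl]] : exists p : seq T, [/\ path adjb x p,
    forall z, z \in p -> W z & last x p = y].
  move/clos_rt_rtn1_iff: xy; elim=> [|a b [Wa Wb ab] _ [p [pp pW pl]]].
    by exists [::].
  exists (rcons p b); split; last by rewrite last_rcons.
    by rewrite rcons_path pp pl; exact/asboolP.
  by move=> z; rewrite mem_rcons inE => /predU1P[->|/pW].
have [q qp [qu qs ql]] : exists2 q, path adjb x q & [/\ uniq ((x : T) :: q),
    {subset q <= p} & last x q = y].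
  by case/shortenP: pp pl => q qp qu qs ql; exists q.
have Kq : has (fun z : T => `[< K z >]) q.
  have : (y : T) \in (x : T) :: q by rewrite -[y]ql mem_last.
  rewrite inE => /predU1P[yx|yq]; first by case: Kx; rewrite -yx.
  by apply/hasP; exists y => //; exact/asboolP.
set i := find (fun z : T => `[< K z >]) q.
have iq : (i < size q)%N by rewrite -has_find.
have sz : size (take i.+1 q) = i.+1 by rewrite size_takel.
have lE : last (x : T) (take i.+1 q) = nth x q i.
  by rewrite -nth_last sz /= nth_take // (set_nth_default x) // size_takel.
exists (take i.+1 q); split.
- by rewrite -size_eq0 sz.
- exact: take_path.
- by have := take_uniq i.+2 qu.
- by move=> z /mem_take/qs/pW.
split; first by rewrite lE; apply/asboolP/(@nth_find T x (fun z : T => `[< K z >])).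
move=> z zq Kz; rewrite lE.
  have zi : (index z (take i.+1 q) < i.+1)%N by rewrite -[X in (_ < X)%N]sz index_mem.
  have := nth_index (x : T) zq; rewrite nth_take // => zE.
  move: zi; rewrite ltnS leq_eqVlt => /predU1P[<- //|/(before_find (x : T))].
  by rewrite zE => /asboolP.
Qed.

Definition simple (p : seq T) : bool :=
  if p is x :: s then path adjb x s && uniq p else false.

Lemma simple_cat (x0 : T) p s : simple p -> path adjb (last x0 p) s ->
  uniq s -> (forall z, z \in s -> z \notin p) -> simple (p ++ s).
Proof.
case: p => // x p /andP[pp pu] ps us sp; apply/andP; split.
  by rewrite cat_path pp.
by rewrite (cat_uniq (x :: p)) pu us andbT; apply/hasPn => z /sp.
Qed.

Section Concat.
Variables (x0 : T) (P : nat -> seq T).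
Hypothesis simpleP : forall n, simple (P n).
Hypothesis growP : forall n, exists2 s, s != [::] & P n.+1 = P n ++ s.

Lemma concat_prefix m n : (m <= n)%N -> exists s, P n = P m ++ s.
Proof.
elim: n => [|n IH]; first by rewrite leqn0 => /eqP ->; exists [::]; rewrite cats0.
rewrite leq_eqVlt => /predU1P[->|/IH[s sE]]; first by exists [::]; rewrite cats0.
by have [t _ ->] := growP n; exists (s ++ t); rewrite sE catA.
Qed.

Lemma concat_size n : (n < size (P n))%N.
Proof.
elim: n => [|n IH]; first by have := simpleP 0; case: (P 0).
have [[//|t s] _ ->] := growP n.
by rewrite size_cat /= addnS ltnS (leq_trans IH) // leq_addr.
Qed.

Lemma concat_nth k n : (k < size (P n))%N -> nth x0 (P n) k = nth x0 (P k) k.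
Proof.
move=> kn; have [/concat_prefix[s sE]|/ltnW/concat_prefix[s sE]] := leqP n k.
  by rewrite sE nth_cat kn.
by rewrite sE nth_cat concat_size.
Qed.

(** Each [P n] has more than [n] entries, so the diagonal entries [nth x0 (P n) n] are stable;
    injectivity and adjacency can be read off a single [P m]. Positions beyond [size (P n)] carry
    vertices outside [P n], because a longer [P m] has no repetitions; so a set [W] containing
    everything appended later contains a tail. *)
Lemma concat_ray : exists r : ray G,
  (forall n k, (k < size (P n))%N -> sval r k = nth x0 (P n) k) /\
  forall W n, (forall m z, (n <= m)%N -> z \in P m -> z \in P n \/ W z) ->
    has_tail_in r W.
Proof.
have [rI radj] : injective (fun k => nth x0 (P k) k : G) /\
    forall n, adj (nth x0 (P n) n : G) (nth x0 (P n.+1) n.+1 : G).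
  split=> [j k /= jk|n].
    pose m := maxn j k.
    have jm : (j < size (P m))%N by rewrite (leq_ltn_trans (leq_maxl j k))// concat_size.
    have km : (k < size (P m))%N by rewrite (leq_ltn_trans (leq_maxr j k))// concat_size.
    have /eqP : nth x0 (P m) j = nth x0 (P m) k by rewrite !concat_nth.
    rewrite nth_uniq //; first by move/eqP.
    by have := simpleP m; case: (P m) => // a s /andP[].
  have n1 := concat_size n.+1.
  rewrite -(concat_nth (ltnW n1)).
  have := simpleP n.+1; case: (P n.+1) n1 => // a s n1 /andP[/(pathP x0) h _].
  by have := h n n1 => /asboolP.
pose r : ray G := exist (fun r : nat -> G => injective r /\ forall n, adj (r n) (r n.+1))
  (fun k => nth x0 (P k) k) (conj rI radj).
exists r; split=> /= [n k kn|W n PW].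
  by rewrite (concat_nth kn).
exists (size (P n)) => m nm /=.
have nm' : (n <= m)%N by rewrite (leq_trans _ nm)// ltnW// concat_size.
have [//|s sE] := @concat_prefix n m.
have := PW m (nth x0 (P m) m) nm' (mem_nth _ (concat_size m)).
case=> // mn; exfalso.
have pu : uniq (P m) by have := simpleP m; case: (P m) => // a t /andP[].
have := concat_size m; rewrite sE size_cat => szm.
move: pu mn; rewrite sE cat_uniq nth_cat ltnNge nm /= => /and3P[_ /hasPn h _].
by apply/negP/h/mem_nth; rewrite -(ltn_add2l (size (P n))) subnKC.
Qed.

End Concat.

(** Dependent choice; the invariant [I] is packed into a subtype, so that the successor is a total
    function that can be iterated. *)
Lemma dependent_seq (S : Type) (I : S -> Prop) (Q : S -> S -> Prop) (s0 : S) :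
  I s0 -> (forall s, I s -> exists2 t, I t & Q s t) ->
  exists f : nat -> S, [/\ f 0 = s0, forall n, I (f n) & forall n, Q (f n) (f n.+1)].
Proof.
move=> I0 step.
have step' (s : {s | I s}) : exists t : {s | I s}, Q (sval s) (sval t).
  by have [t It Qt] := step _ (svalP s); exists (exist _ t It).
pose next s := sval (cid (step' s)).
exists (fun n => sval (iter n next (exist _ s0 I0))); split=> // n.
- exact: svalP.
- by rewrite iterS; exact: (svalP (cid (step' _))).
Qed.

Lemma finite_eventually (T' : Type) (Z : set T') (Q : T' -> nat -> Prop) :
  finite_set Z ->
  (forall z, Z z -> exists N, forall n, (N <= n)%N -> Q z n) ->
  exists N, forall z n, Z z -> (N <= n)%N -> Q z n.
Proof.
move=> finZ; have /finite_seqP[s sE] : finite_set (Z : set {classic T'}) := finZ.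
rewrite sE => h.
elim: s {sE} h => [_|a s IH h]; first by exists 0%N.
have [|N1 h1] := IH; first by move=> z zs; apply: h; rewrite /= inE zs orbT.
have [|N2 h2] := h a; first by rewrite /= mem_head.
exists (maxn N1 N2) => z n /=; rewrite inE geq_max => /predU1P[->|zs] /andP[n1 n2].
  exact: h2.
exact: h1.
Qed.

Lemma has_tail_sub r A B : has_tail_in r A -> A `<=` B -> has_tail_in r B.
Proof. by move=> [n rA] AB; exists n => m /rA/AB. Qed.

Section Direction.
Variable c : set G -> set G.
Hypothesis cP : forall X, finite_set X -> components X (c X).
Hypothesis c_mono : forall X Y, finite_set Y -> X `<=` Y -> c Y `<=` c X.

Let U := [set u | forall X, finite_set X -> ~ X u -> c X u].

Lemma direction_meet r X : finite_set X -> 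
  (forall D, components X D -> has_tail_in r D -> D `&` c X !=set0) ->
  has_tail_in r (c X).
Proof.
move=> finX h; have [D [cD rD _]] := @ray_equiv_refl _ r X finX.
have [y [Dy cy]] := h D cD rD.
by rewrite -(components_eq cD (cP finX) Dy cy).
Qed.

(* [U] consists of the vertices dominating the direction [c]; if there are
   infinitely many, they can be strung together on a ray. *)
Lemma direction_ray_dominated : ~ finite_set U ->
  exists r : ray G, forall X, finite_set X -> has_tail_in r (c X).
Proof.
move=> infU; have [x0 Ux0] := infinite_setN0 infU.
pose last0 (P : seq T) : T := last (x0 : T) P.
have [||f [_ fI fQ]] := @dependent_seq (seq T)
  (fun P => simple P /\ U (last0 P))
  (fun P P' => exists2 s, s != [::] & P' = P ++ s) [:: (x0 : T)].
- by [].
- move=> P [sP UP]; pose p := last0 P.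
  pose X : set G := [set` P].
  have finX : finite_set X by exact: (@finite_seq T P).
  (* All of [P] is deleted except its end [p]. Both [p] and the fresh vertex [u] dominate the
     direction, so they lie in the same component, and a path between them avoids the rest of
     [P]. *)
  have finXp : finite_set (X `\ (p : G)) by exact: finite_setD.
  have [u [Uu Pu]] := infinite_setN0 (infinite_setD infU finX).
  have cp : c (X `\ (p : G)) p by apply: UP => // -[_]; exact.
  have cu : c (X `\ (p : G)) u by apply: Uu => // -[].
  have [|s [s0 sp su sc [sl _]]] :=
    @simple_path _ [set u] _ _ (component_linked (cP finXp) cp cu) cp _ erefl.
    move=> pu; apply: Pu; rewrite -pu; change (p \in P).
    by move: sP; rewrite /p /last0; case: (P) => // a t _; exact: (@mem_last T a t).
  exists (P ++ s); last by exists s.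
  split; last by rewrite /last0 last_cat sl.
  apply: simple_cat sP sp _ _; first by case/andP: su.
  move=> z zs; apply/negP => zP; apply: (component_disjoint (cP finXp) (sc z zs)).
  by split=> //= zp; case/andP: su; rewrite -[p]zp zs.
have sf n : simple (f n) by case: (fI n).
have [r [rE _]] := concat_ray x0 sf fQ.
exists r => X finX; apply: direction_meet => // D cD [n nD].
(* The last vertex of [f n] lies in [U], and its position on the ray is at least [n], hence in the
   tail; being in [U], it belongs to [c X] as soon as it avoids [X]. *)
pose k := (size (f n)).-1.
have szn := concat_size sf fQ n.
have kE : sval r k = last0 (f n).
  by rewrite (rE n) ?prednK ?(leq_ltn_trans _ szn)// /k nth_last /last0;
     case: (f n) szn.
have nk : (n <= k)%N by rewrite -ltnS prednK ?(leq_ltn_trans _ szn).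
have Dk := nD k nk.
exists (sval r k); split=> //.
rewrite kE; apply: (fI n).2 => // Xk.
by apply: (component_disjoint cD Dk); rewrite kE.
Qed.

(** A vertex [a] outside [U] has a finite set [S a] avoiding it with [a] not in [c (S a)]. Once [Y]
    contains [S a], a neighbour of [a] in [c Y] would lie in [c (S a)] and pull [a] into that
    component. *)
Lemma direction_escape X : finite_set X ->
  exists Y, [/\ finite_set Y, X `<=` Y &
    forall a b, X a -> ~ U a -> adj a b -> ~ c Y b].
Proof.
move=> finX.
have /choice[S SP] : forall a : G, exists S, finite_set S /\
    (~ U a -> ~ S a /\ ~ c S a).
  move=> a; have [Ua|Ua] := pselect (U a); first by exists set0.
  apply: contrapT => h; apply: Ua => S finS Sa; apply: contrapT => cSa.
  by apply: h; exists S.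
exists (X `|` \bigcup_(a in X) S a); split.
- rewrite finite_setU; split=> //; apply: bigcup_finite => // a _.
  exact: (SP a).1.
- by move=> x; left.
- move=> a b Xa Ua ab cb.
  have [finS /(_ Ua)[Sa cSa]] := SP a.
  apply: cSa; apply: (component_adj (cP finS) _ (adj_sym ab) Sa).
  apply: c_mono cb; last by move=> x Sx; right; exists a.
  rewrite finite_setU; split=> //; apply: bigcup_finite => // z _.
  exact: (SP z).1.
Qed.

(* By [direction_escape] there are [X_n] such that the neighbours of [c X_n.+1] in
   [X_n] dominate [c]. Then no vertex stays in all [c X_n], since a path to it from
   outside would meet every [X_n]. *)
Lemma direction_ray_undominated : finite_set U ->
  exists r : ray G, forall X, finite_set X -> has_tail_in r (c X).
Proof.
move=> finU; have [x0 cx0] := component_ex (cP finU).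
pose last0 (P : seq T) : T := last (x0 : T) P.
(* A state is a path together with a finite set. The path meets [c] of the set only in its last
   vertex, so the next piece, which stays inside that component, is disjoint from the path. *)
have [||f [_ fI fQ]] := @dependent_seq (seq T * set G)
  (fun d => [/\ simple d.1, finite_set d.2, U `<=` d.2, c d.2 (last0 d.1) &
     forall z, z \in d.1 -> c d.2 z -> z = last0 d.1])
  (fun d e => [/\ exists s, [/\ s != [::], e.1 = d.1 ++ s &
       forall z, z \in s -> c d.2 z], d.2 `<=` e.2, e.2 (last0 d.1) &
     forall a b, d.2 a -> ~ U a -> adj a b -> ~ c e.2 b])
  ([:: (x0 : T)], U).
- by split=> //= z; rewrite inE => /eqP.
- move=> [P X] [/= sP finX UX cXp Pp]; pose p := last0 P.
  (* The end [p] of the path is put into the next set: the path then has to move on, and the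
     starting vertex is known to be deleted from stage 1 on. *)
  have finXp : finite_set (X `|` [set (p : G)]) by rewrite finite_setU.
  have [Y [finY XY Yout]] := direction_escape finXp.
  have [q cq] := component_ex (cP finY).
  have XsY : X `<=` Y by move=> z Xz; apply: XY; left.
  have Yp : Y p by apply: XY; right.
  have cYp : ~ c Y p by move=> /(component_disjoint (cP finY)).
  have cXq : c X q by exact: c_mono cq.
  have [s [s0 sp su sc [sl slast]]] :=
    simple_path (component_linked (cP finX) cXp cXq) cXp cYp cq.
  exists (P ++ s, Y); split=> //=.
  + apply: simple_cat sP sp _ _; first by case/andP: su.
    move=> z zs; apply/negP => zP; have zp := Pp z zP (sc z zs).
    case/andP: su => /negP su _; apply: su.
    by change (last0 P \in s); rewrite -zp.
  + by move=> u /UX /XsY.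
  + by rewrite /last0 last_cat.
  + move=> z; rewrite mem_cat => /orP[zP cz|/slast]; last by rewrite /last0 last_cat.
    by case: cYp; rewrite /p -(Pp z zP) //; exact: c_mono cz.
  + by exists s.
  + by move=> a b Xa; apply: Yout; left.
have sf n : simple (f n).1 by case: (fI n).
have fin n : finite_set (f n).2 by case: (fI n).
have [n|r [_ rW]] := concat_ray (x0 : T) sf.
  by have [[s [s0 sE _]] _ _ _] := fQ n; exists s.
have Xmono m n : (m <= n)%N -> (f m).2 `<=` (f n).2.
  elim: n => [|n IH]; first by rewrite leqn0 => /eqP ->.
  rewrite leq_eqVlt => /predU1P[->//|/IH h] x /h; by have [_ + _ _] := fQ n; apply.
have cmono m n : (m <= n)%N -> c (f n).2 `<=` c (f m).2.
  by move=> mn; apply: c_mono => //; exact: Xmono.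
have rtail n : has_tail_in r (c (f n).2).
  apply: (rW _ n) => m z; elim: m => [|m IH].
    by rewrite leqn0 => /eqP ->; left.
  rewrite leq_eqVlt => /predU1P[->|nm]; first by left.
  have [[s [_ -> sc]] _ _ _] := fQ m.
  rewrite mem_cat => /orP[/IH|/sc cz]; first exact.
  by right; exact: cmono cz.
have edge_ev (a b : G) m : adj a b -> (f m).2 a -> ~ U a ->
    forall n, (m < n)%N -> ~ c (f n).2 a /\ ~ c (f n).2 b.
  move=> ab ma Ua n mn; split.
    by move=> /(component_disjoint (cP (fin n))); apply; exact: Xmono (ltnW mn) _ ma.
  move=> /(cmono _ _ mn) cb; have [_ _ _ h] := fQ m.
  exact: h ma Ua ab cb.
(* If an endpoint of an edge outside [U] is ever deleted, both endpoints are eventually outside the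
   chosen components; otherwise each of these components contains both or neither. Membership
   therefore agrees eventually along every walk that avoids [U]. *)
have linked_ev (a b : G) : linked (~` U) a b ->
    exists N, forall n, (N <= n)%N -> (c (f n).2 a <-> c (f n).2 b).
  elim=> [{}a {}b [Ua Ub ab]|{}a|{}a {}b d _ [N1 h1] _ [N2 h2]].
  - have [[m ma]|na] := pselect (exists m, (f m).2 a).
      exists m.+1 => n mn; have [] := edge_ev a b m ab ma Ua n mn; tauto.
    have [[m mb]|nb] := pselect (exists m, (f m).2 b).
      exists m.+1 => n mn; have [] := edge_ev b a m (adj_sym ab) mb Ub n mn; tauto.
    exists 0%N => n _; split=> [ca|cb].
      by apply: (component_adj (cP (fin n)) ca ab) => nb'; apply: nb; exists n.
    by apply: (component_adj (cP (fin n)) cb (adj_sym ab)) => na'; apply: na; exists n.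
  - by exists 0%N.
  - exists (maxn N1 N2) => n; rewrite geq_max => /andP[/h1 + /h2]; tauto.
(* A vertex of the initial component is linked outside [U] to the end of the initial path, which is
   deleted from stage 1 on. *)
have vertex_ev (z : G) : exists N, forall n, (N <= n)%N -> ~ c (f n).2 z.
  have [cz|cz] := pselect (c (f 0%N).2 z); last first.
    by exists 0%N => n _ /(cmono _ _ (leq0n n)).
  have [_ fin0 U0 cl _] := fI 0%N.
  have : linked (~` U) (last0 (f 0%N).1 : G) z.
    apply: linked_sub (component_linked (cP fin0) cl cz) => t.
    by move=> /(component_disjoint (cP fin0)) h /U0.
  move=> /linked_ev[N h]; exists (maxn N 1) => n.
  rewrite geq_max => /andP[/h + n1].
  have [_ _ p1 _] := fQ 0%N; have Xp := Xmono _ _ n1 _ p1.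
  have : ~ c (f n).2 (last0 (f 0%N).1) by move=> /(component_disjoint (cP (fin n))).
  tauto.
exists r => Z finZ.
have [N hN] := finite_eventually finZ (fun z _ => vertex_ev z).
(* At stage [N] the component avoids [Z], and it meets [c Z] because [c] of the union of the two
   finite sets lies in both; being connected, it is contained in [c Z]. *)
apply: (has_tail_sub (rtail N)).
have finXZ : finite_set ((f N).2 `|` Z) by rewrite finite_setU.
have [y cy] := component_ex (cP finXZ).
have cNy : c (f N).2 y by apply: c_mono cy => // t; left.
have cZy : c Z y by apply: c_mono cy => // t; right.
apply: (component_sub (cP (fin N)) _ (cP finZ) cNy cZy).
by apply/seteqP; split=> // t [ct /hN/(_ (leqnn N))].
Qed.

Theorem direction_end :
  exists w : ends G, forall X, finite_set X -> end_comp X w = c X.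
Proof.
have [r rP] : exists r : ray G, forall X, finite_set X -> has_tail_in r (c X).
  have [/direction_ray_undominated//|/direction_ray_dominated//] :=
    pselect (finite_set U).
have [w wr] := ray_end r.
by exists w => X finX; apply: end_comp_eq wr (cP finX) (rP X finX).
Qed.

End Direction.

End Directions.

(** * Toughness of vertex sets *)

Section RelativeToughness.
Variable G : graph.
Implicit Types (X Y A B C D W : set G).

(** The components of the subgraph induced on [W], kept as sets of vertices of [G] so that no
    subtype is involved. *)
Definition classes W : set (set G) :=
  [set C | exists2 x, W x & C = [set y | linked W x y]].

Definition tough_in A : Prop := forall Y, finite_set Y -> finite_set (classes (A `\` Y)).

Lemma tough_inT : tough_in setT <-> tough G.
Proof. by split=> h Y /h; rewrite setTD. Qed.

Lemma linked_induced A (W : set (Defs.induced A)) (x : Defs.induced A) (y : G) :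
  linked (set_val @` W) (set_val x) y <->
  exists2 y' : Defs.induced A, set_val y' = y & linked W x y'.
Proof.
split=> [|[y' <-]].
  move/clos_rt_rtn1_iff; elim=> [|a b [[a0 Wa aE] [b' Wb <-] ab] _ [a' a'E xa]].
    by exists x => //; exact: rt_refl.
  exists b' => //; apply: rt_trans xa _; apply: rt_step.
  have <- : a0 = a' by apply: val_inj; exact: etrans aE (esym a'E).
  by split=> //; move: ab; rewrite -aE.
elim=> [a b [Wa Wb ab]|a|a b c _ ab _ bc].
- by apply: rt_step; split.
- exact: rt_refl.
- exact: rt_trans ab bc.
Qed.

Lemma classes_induced A (W : set (Defs.induced A)) (x : Defs.induced A) :
  set_val @` [set y | linked W x y] =
  [set y | linked (set_val @` W) (set_val x) y].
Proof.
apply/seteqP; split=> [_ [y /= xy <-]|y /= /linked_induced[y' <- xy]].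
  by apply/linked_induced; exists y.
by exists y'.
Qed.

Lemma tough_induced A : tough (Defs.induced A) <-> tough_in A.
Proof.
have imC (Z : set (Defs.induced A)) Y : Z = set_val @^-1` Y ->
    set_val @` (~` Z) = A `\` Y.
  move=> ->; apply/seteqP; split=> [_ [z /= Yz <-]|z [Az Yz]].
    by split=> //; exact: set_valP.
  by exists (exist _ z (mem_set Az)).
split=> tA Y finY.
  pose Z : set (Defs.induced A) := set_val @^-1` Y.
  have finZ : finite_set Z by apply: finite_preimage => // a b _ _; exact: val_inj.
  have := finite_image (fun D : set (Defs.induced A) => set_val @` D : set G) (tA Z finZ).
  apply: sub_finite_set.
  move=> _ [x [Ax Yx] ->]; pose x' : Defs.induced A := exist _ x (mem_set Ax).
  exists [set y | linked (~` Z) x' y]; first by exists x'.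
  by rewrite classes_induced (imC Z Y).
have finY' : finite_set (set_val @` Y) by exact: finite_image.
have YE : Y = set_val @^-1` (set_val @` Y).
  apply/seteqP; split=> [y Yy|y [z Yz /val_inj <- //]]; by exists y.
have := finite_image (fun D : set G => set_val @^-1` D : set (Defs.induced A)) (tA _ finY').
apply: sub_finite_set.
move=> _ [x Yx ->]; exists (set_val @` [set y | linked (~` Y) x y]).
  exists (set_val x); first by rewrite -(imC _ _ YE); exists x.
  by rewrite classes_induced (imC _ _ YE).
apply/seteqP; split=> [y [z xz /val_inj <- //]|y xy]; by exists y.
Qed.

(* [A] is a union of components of [G - X]. *)
Definition closed_off X A : Prop :=
  A `&` X = set0 /\ forall x y, A x -> adj x y -> A y \/ X y.

Lemma closed_offT : closed_off set0 setT.
Proof. by split; [rewrite setI0|left]. Qed.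

Lemma closed_off_component X C : components X C -> closed_off X C.
Proof.
move=> cC; split; first by apply/seteqP; split=> // x [/(component_disjoint cC)].
move=> x y Cx xy; have [Xy|Xy] := pselect (X y); first by right.
by left; exact: component_adj xy Xy.
Qed.

(** Edges leave [A] only into [X], so a walk avoiding [X] that starts in [A] remains there. This
    makes relative toughness of [A] a statement about components of [G] minus a finite set. *)
Lemma closed_off_classes X A Y : closed_off X A -> 
  classes (A `\` Y) = [set D | components (X `|` Y) D /\ D `<=` A].
Proof.
move=> [AX Aadj].
have AXn x : A x -> ~ X x by move=> Ax Xx; have : (A `&` X) x by []; rewrite AX.
have lE x : (A `\` Y) x ->
    [set y | linked (A `\` Y) x y] = [set y | linked (~` (X `|` Y)) x y].
  move=> [Ax Yx]; apply/seteqP; split=> y /=.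
    by apply: linked_sub => z [Az Yz] [/(AXn z Az)|].
  move/clos_rt_rtn1_iff; elim=> [|a b [a1 b1 ab] _ IH]; first exact: rt_refl.
  have [Aa Ya] : (A `\` Y) a by exact: (linked_in IH).
  apply: rt_trans IH (rt_step _ _ _ _ _).
  split=> //; split; last by move=> Yb; apply: b1; right.
  by have [//|Xb] := Aadj _ _ Aa ab; case: b1; left.
apply/seteqP; split=> D.
  move=> [x AYx ->]; split.
    by exists x; [case: AYx => Ax Yx [/(AXn _ Ax)|]|exact: lE].
  by move=> y /linked_in/(_ AYx)[].
move=> [[x XYx ->] DA]; have Ax : A x by apply: DA; exact: rt_refl.
have AYx : (A `\` Y) x by split=> // Yx; apply: XYx; right.
by exists x => //; rewrite lE.
Qed.

End RelativeToughness.

(** * Tangles *)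

Section Tangles.
Variable G : graph.
Implicit Types (X Y A B C D : set G) (p q s : set G * set G).

Section Tangle.
Variable t : set (set G * set G).
Hypothesis tP : aleph0_tangle t.

Lemma tangle_sep p : t p -> separations p.
Proof. by case: tP => + _ _ _; apply. Qed.

Lemma tangle_or p : separations p -> t p \/ t (flip p).
Proof. by case: tP => _ + _ _ => /[apply] -[q [[tq [<-|<-]] _]]; [left|right]. Qed.

Lemma tangle_infinite2 p q : t p -> t q -> sep_le p (flip q) ->
  ~ finite_set (p.2 `&` q.2).
Proof.
case: tP => tsub _ _ tstar tp tq [pq qp] fin.
apply: (tstar [set p; q]).
- by move=> _ [->|->].
- split; first by move=> _ [->|->]; exact: tsub.
  by move=> _ _ [->|->] [->|->].
- by rewrite finite_setU.
- apply: sub_finite_set fin => x xI.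
  by split; apply: xI; [left|right].
Qed.

Lemma tangle_infinite p : t p -> ~ finite_set p.2.
Proof.
case: tP => tsub _ _ tstar tp fin.
apply: (tstar [set p]) => //.
- by move=> _ ->.
- by split=> [_ ->|_ _ -> ->//]; exact: tsub.
- by apply: sub_finite_set fin => x; apply.
Qed.

Lemma corner_separation A B C D : separations (A, B) -> separations (C, D) ->
  separations (B `&` C, A `|` D).
Proof.
move=> [/= ABT finAB AB] [/= CDT finCD CD]; split=> /=.
- apply/seteqP; split=> // x _.
  have [Ax|Bx] : (A `|` B) x by rewrite ABT.
    by right; left.
  have [Cx|Dx] : (C `|` D) x by rewrite CDT.
    by left.
  by right; right.
- apply: (@sub_finite_set _ _ ((A `&` B) `|` (C `&` D))); last by rewrite finite_setU.
  by move=> x [[Bx Cx] [Ax|Dx]]; [left|right].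
- move=> x y [[Bx Cx] /not_orP[Ax Dx]] [_ /not_andP[By|Cy]] xy.
    have [Ay|//] : (A `|` B) y by rewrite ABT.
    by apply: (AB y x) => //; exact: adj_sym.
  have [//|Dy] : (C `|` D) y by rewrite CDT.
  exact: (CD x y).
Qed.

(* For [p = (A, B)] and [q = (C, D)] with [B `&` D] finite, [p] and the corner
   [(B `&` C, A `|` D)] form a star of finite interior. *)
Lemma tangle_meet_infinite p q : t p -> t q -> ~ finite_set (p.2 `&` q.2).
Proof.
case: p q => A B [C D] tp tq /= fin.
have sep := corner_separation (tangle_sep tp) (tangle_sep tq).
have [_ _ tcons _] := tP.
suff ts : t (B `&` C, A `|` D).
  apply: (tangle_infinite2 tp ts) => /=.
    by split=> /= [x Ax|x []//]; left.
  have [_ /= finAB _] := tangle_sep tp.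
  apply: (@sub_finite_set _ _ ((A `&` B) `|` (B `&` D))); last by rewrite finite_setU.
  by move=> x [Bx [Ax|Dx]]; [left|right].
have [//|tf] := tangle_or sep.
(* Consistency speaks of distinct separations only, so two coincidences are treated apart. In the
   first, [D] is contained in [B], hence finite, which no tangle allows; in the second, the corner
   is [(C, D)] itself. *)
have [qE|qs] := pselect ((A `|` D, B `&` C) = (C, D)).
  case: qE => _ DE; case: (tangle_infinite tq) => /=.
  by apply: sub_finite_set fin => x Dx; split=> //; move: Dx; rewrite -DE => -[].
have [-> //|sq] := pselect ((B `&` C, A `|` D) = (C, D)).
case: (tcons _ _ tf tq qs); split; last exact: sq.
by split=> /= [x []//|x Dx]; right.
Qed.

End Tangle.

Lemma component_separation X C : finite_set X -> components X C ->
  separations (~` C, X `|` C).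
Proof.
move=> finX cC; split=> /=.
- apply/seteqP; split=> // x _.
  by have [Cx|Cx] := pselect (C x); [right; right|left].
- by apply: sub_finite_set finX => x [Cx [|]].
- move=> x y [Cx /not_orP[Xx _]] [[Xy|Cy] yC] /adj_sym xy.
    by apply: yC => /(component_disjoint cC).
  by apply: Cx; exact: component_adj xy Xx.
Qed.

(** If the tangle pointed away from every component of [G - X], the corresponding separations would
    form a star, finite by toughness, with interior inside [X]. So it points to a component for each
    [X]. Two such choices are compatible because second sides of members of a tangle have infinite
    intersection; the choices form a direction, whose end induces the given tangle. *)
Lemma tough_tangle_end : tough G -> forall t : tangles G, exists w, end_tangle w = t.
Proof.
move=> tG [t tP].
have dir X : finite_set X -> exists C, components X C /\ t (~` C, X `|` C).
  move=> finX; apply: contrapT => /forallNP h.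
  have tC C : components X C -> t (X `|` C, ~` C).
    move=> cC; have [tC|//] := tangle_or tP (component_separation finX cC).
    by case: (h C).
  case: (tP) => tsub _ _ tstar.
  apply: (tstar ((fun C => (X `|` C, ~` C)) @` components X)).
  - by move=> _ [C cC <-]; exact: tC.
  - split; first by move=> _ [C cC <-]; exact/tsub/tC.
    move=> _ _ [C cC <-] [D cD <-] CD.
    have CDn x : C x -> ~ D x.
      by move=> Cx Dx; apply: CD; rewrite (components_eq cC cD Cx Dx).
    split=> /= x [Xx|Cx].
    + by move=> /(component_disjoint cD).
    + exact: CDn.
    + by move=> /(component_disjoint cC).
    + by move=> /CDn.
  - exact/finite_image/tG.
  - apply: sub_finite_set finX => x xI; apply: contrapT => Xx.
    have [C cC Cx] := mem_component Xx.
    by have := xI (X `|` C, ~` C); apply=> //; exists C.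
have /choice[c cP] : forall X, exists C, finite_set X -> components X C /\ t (~` C, X `|` C).
  move=> X; have [/dir[C]|] := pselect (finite_set X); first by exists C.
  by exists set0.
have cmp X (finX : finite_set X) : components X (c X) by case: (cP X finX).
have tc X (finX : finite_set X) : t (~` (c X), X `|` c X) by case: (cP X finX).
have c_mono X Y : finite_set Y -> X `<=` Y -> c Y `<=` c X.
  move=> finY XY; have finX := sub_finite_set XY finY.
  have inf := tangle_meet_infinite tP (tc X finX) (tc Y finY).
  have [x [[[Xx|cx] [Yx|dx]] nx]] := infinite_setN0 (infinite_setD inf finY) => //.
  - by case: (component_disjoint (cmp Y finY) dx); exact: XY.
  - exact: component_mono (cmp X finX) (cmp Y finY) cx dx.
have [w wE] := direction_end cmp c_mono.
exists w; apply: eq_exist => /=.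
have mem p : t p -> end_tangle_set w (flip p) -> False.
  move=> tp [sp]; have [_ finp _] := tangle_sep tP tp.
  rewrite /= setIC wE // => sub.
  have inf := tangle_meet_infinite tP tp (tc _ finp).
  have [x [[px [Xx|cx]] nx]] := infinite_setN0 (infinite_setD inf finp) => //.
  by case: (sub _ cx).
apply/seteqP; split=> p hp.
  have [sp _] := hp.
  have [//|tf] := tangle_or tP sp.
  by case: (mem _ tf); rewrite flipK.
have [//|ef] := end_tangle_or w (tangle_sep tP hp).
by case: (mem _ hp).
Qed.

Lemma end_tangle_inj : injective (@end_tangle G).
Proof.
move=> w w' [] E; apply: ends_eq => X finX.
have cX := end_comp_component w finX.
have sX := component_separation finX cX.
have XE : ~` (end_comp X w) `&` (X `|` end_comp X w) = X.
  apply/seteqP; split=> x; first by move=> [? []].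
  by move=> Xx; split; [move=> /(component_disjoint cX)|left].
have : end_tangle_set w (~` (end_comp X w), X `|` end_comp X w).
  split=> //=; rewrite XE => x Cx; split; [by right|exact].
rewrite E => -[_ /=]; rewrite XE => sub.
have cX' := end_comp_component w' finX.
have [y Cy] := component_ex cX'.
have [[/(component_disjoint cX')//|Dy] _] := sub _ Cy.
exact: components_eq cX cX' Dy Cy.
Qed.

End Tangles.

(** * Tangles from free ultrafilters on components *)

Section UltrafilterTangles.
Variable G : graph.
Implicit Types (X Y A B C D : set G) (p q s : set G * set G) (Cs : set (set G)).

Lemma vertices_of_component X Cs C (x : G) : Cs `<=` components X ->
  components X C -> C x -> vertices_of Cs x -> Cs C.
Proof.
by move=> CsX cC Cx [D CsD Dx]; rewrite (components_eq cC (CsX _ CsD) Cx Dx).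
Qed.

Lemma vertices_of_separator X Cs : Cs `<=` components X ->
  ~` vertices_of Cs `&` (X `|` vertices_of Cs) = X.
Proof.
move=> CsX; apply/seteqP; split=> [x [nx [//|/nx//]]|x Xx]; split; last by left.
by move=> [C /CsX cC /(component_disjoint cC)].
Qed.

Lemma vertices_of_side X Cs : Cs `<=` components X ->
  (X `|` vertices_of Cs) `\` ~` vertices_of Cs = vertices_of Cs.
Proof.
move=> CsX; apply/seteqP; split=> [x [_ /contrapT//]|x Vx].
by split; [right|apply].
Qed.

Lemma vertices_of_separations X Cs : finite_set X -> Cs `<=` components X ->
  separations (~` vertices_of Cs, X `|` vertices_of Cs).
Proof.
move=> finX CsX; split; rewrite /= ?vertices_of_separator //.
- apply/seteqP; split=> // x _.
  by have [Vx|Vx] := pselect (vertices_of Cs x); [right; right|left].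
- move=> x y [nVx /not_orP[Xx _]] [_ /contrapT[C CsC Cy]] /adj_sym yx.
  by apply: nVx; exists C => //; exact: component_adj (CsX _ CsC) Cy yx Xx.
Qed.

Lemma end_tangle_vertices_of X Cs w : finite_set X -> Cs `<=` components X ->
  end_tangle_set w (~` vertices_of Cs, X `|` vertices_of Cs) <-> Cs (end_comp X w).
Proof.
move=> finX CsX; rewrite /end_tangle_set /= vertices_of_separator // vertices_of_side //.
have cX := end_comp_component w finX.
split=> [[_ sub]|CsC].
  have [x Cx] := component_ex cX.
  exact: vertices_of_component CsX cX Cx (sub _ Cx).
by split; [exact: vertices_of_separations|move=> x Cx; exists (end_comp X w)].
Qed.

Lemma component_side X C p : components X C -> separations p ->
  C `&` (p.1 `&` p.2) = set0 -> C `<=` p.2 `\` p.1 \/ C `<=` p.1 `\` p.2.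
Proof.
case: p => A B cC /= [/= ABT _ AB] CAB; have [x Cx] := component_ex cC.
have nAB y : C y -> ~ (A y /\ B y).
  by move=> Cy yAB; have : (C `&` (A `&` B)) y by []; rewrite CAB.
have AoB y : A y \/ B y by have : (A `|` B) y by rewrite ABT.
have [Ax|Bx] := AoB x.
  right=> y /(component_linked cC Cx)/clos_rt_rtn1_iff.
  elim=> [|a b [Ca Cb ab] _ [Aa Ba]]; first by split=> // Bx; case: (nAB x).
  have := AB a b; have := AoB b; have := nAB b Cb; rewrite /setD/=; tauto.
left=> y /(component_linked cC Cx)/clos_rt_rtn1_iff.
elim=> [|a b [Ca Cb ab] _ [Ba Aa]]; first by split=> // Ax; case: (nAB x).
have := AB b a; have := AoB b; have := nAB b Cb; have := adj_sym ab; rewrite /setD/=; tauto.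
Qed.

Lemma finite_meeting_components X Y : finite_set Y ->
  finite_set [set C | components X C /\ C `&` Y !=set0].
Proof.
move=> finY; have := finite_image (fun y => [set z | linked (~` X) y z]) finY.
apply: sub_finite_set => C [cC [y [Cy Yy]]]; exists y => //.
by have [_ ->] := componentsE cC Cy.
Qed.

Section UltrafilterTangle.
Variables (X : set G) (F : set_system (set G)).
Hypothesis ultraF : UltraFilter F.
Hypothesis F_components : F (components X).
Hypothesis F_free : forall S, finite_set S -> ~ F S.

Definition ultra_tangle_set : set (set G * set G) :=
  [set p | separations p /\ F [set C | components X C /\ C `<=` p.2 `\` p.1]].

(** A finite set meets only finitely many components of [G - X], and these are negligible for the
    free ultrafilter. Every other component lies strictly on one side of a given separation, so the
    ultrafilter decides for a side; and a finite interior of a finite star would contain almost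
    every component. *)
Lemma ultra_tangle_aleph0_tangle : aleph0_tangle ultra_tangle_set.
Proof.
have FF : ProperFilter F := ultra_proper.
have dich S : F S \/ F (~` S) by exact: in_ultra_setVsetC.
have excl p : ultra_tangle_set p -> ultra_tangle_set (flip p) -> False.
  move=> [_ F1] [_ F2]; have [C [[cC C1] [_ C2]]] := filter_ex (filterI F1 F2).
  by have [x Cx] := component_ex cC; have [_ +] := C1 x Cx; have [+ _] := C2 x Cx.
have tor p : separations p -> ultra_tangle_set p \/ ultra_tangle_set (flip p).
  move=> sp; have [|nF] := dich [set C | components X C /\ C `<=` p.2 `\` p.1].
    by left.
  right; split; first exact: separations_flip.
  have [_ finp _] := sp.
  have [/(F_free (finite_meeting_components X finp))//|F2] :=
    dich [set C | components X C /\ C `&` (p.1 `&` p.2) !=set0].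
  apply: filterS (filterI F_components (filterI nF F2)) => C [cC [n1 n2]]; split=> //.
  have [|h|//] := component_side cC sp; last by case: n1.
  by apply: contrapT => /eqP/set0P h; apply: n2.
split=> [p []//|p sp|p q tp tq _ [[sub _] _]|s st _ fins].
- have [tp|tp] := tor p sp.
    exists p; split; first by split=> //; left.
    by move=> q [tq [->//|qE]]; case: (excl p tp); rewrite -qE.
  exists (flip p); split; first by split=> //; right.
  move=> q [tq [qE|->//]]; case: (excl (flip p) tp).
  by rewrite flipK -qE.
- have [_ F1] := tp; have [_ F2] := tq.
  have [C [[cC C1] [_ C2]]] := filter_ex (filterI F1 F2).
  have [x Cx] := component_ex cC.
  have [_ +] := C2 x Cx; apply; apply: sub.
  by have [] := C1 x Cx.
- move=> fin.
  have FI : F [set C | components X C /\ C `<=` star_interior s].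
    have /finite_seqP[l sE] : finite_set s := fins.
    have lt p : p \in l -> F [set C | components X C /\ C `<=` p.2 `\` p.1].
      by move=> pl; apply: (st p _).2; rewrite sE.
    rewrite /star_interior sE; elim: l {sE} lt => [_|p l IH lt].
      by apply: filterS F_components => C cC; split.
    have Fl := IH (fun q ql => lt q (mem_behead (s := p :: l) ql)).
    apply: filterS (filterI (lt p (mem_head _ _)) Fl) => C [[cC Cp] [_ Cl]]; split=> // x Cx q /=.
    by rewrite inE => /predU1P[->|ql]; [case: (Cp x Cx)|exact: Cl].
  apply: (F_free (finite_meeting_components X fin)).
  apply: filterS FI => C [cC Cs]; split=> //; have [x Cx] := component_ex cC.
  by exists x; split=> //; exact: Cs.
Qed.

Definition ultra_tangle : tangles G := exist _ _ ultra_tangle_aleph0_tangle.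

Lemma ultra_tangle_vertices_of Cs : finite_set X -> Cs `<=` components X ->
  sval ultra_tangle (~` vertices_of Cs, X `|` vertices_of Cs) <-> F Cs.
Proof.
move=> finX CsX; rewrite /= /ultra_tangle_set /= vertices_of_side //.
have -> : [set C | components X C /\ C `<=` vertices_of Cs] = Cs.
  apply/seteqP; split=> C; last by move=> CsC; split; [exact: CsX|move=> x Cx; exists C].
  move=> [cC sub]; have [x Cx] := component_ex cC.
  exact: vertices_of_component CsX cC Cx (sub x Cx).
by split=> [[]//|]; split=> //; exact: vertices_of_separations.
Qed.

(** An end singles out one component of [G - X], whereas a free ultrafilter contains no
    singleton. *)
Lemma ultra_tangle_not_end w : finite_set X -> end_tangle w <> ultra_tangle.
Proof.
move=> finX E; have cX := end_comp_component w finX.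
have sub : [set end_comp X w] `<=` components X by move=> _ ->.
have : sval (end_tangle w)
    (~` vertices_of [set end_comp X w], X `|` vertices_of [set end_comp X w]).
  by apply/end_tangle_vertices_of.
by rewrite E => /(ultra_tangle_vertices_of finX sub)/(F_free (finite_set1 _)).
Qed.

End UltrafilterTangle.

Lemma free_ultrafilter (T : Type) (S : set T) : ~ finite_set S ->
  exists F : set_system T, [/\ UltraFilter F, F S & forall B : set T, finite_set B -> ~ F B].
Proof.
move=> infS; pose F0 : set_system T := [set A : set T | finite_set (S `\` A)].
have F0P : ProperFilter F0.
  split; first by rewrite /F0 /= setD0.
  split; rewrite /F0 /=.
  - by rewrite setDT.
  - move=> A B finA finB.
    apply: (@sub_finite_set _ _ ((S `\` A) `|` (S `\` B))); last by rewrite finite_setU.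
    by move=> x [Sx /not_andP[nA|nB]]; [left|right].
  - by move=> A B AB; apply: sub_finite_set => x [Sx Bx]; split=> // /AB.
have [F [ultraF F0F]] := ultraFilterLemma F0P.
exists F; split=> //; first by apply: F0F; rewrite /F0 /= setDv.
move=> A finA FA; have FF : ProperFilter F := ultra_proper.
have FnA : F (~` A) by apply: F0F; rewrite /F0 /= setDE setCK; exact: finite_setIr.
by have [x []] := filter_ex (filterI FA FnA).
Qed.

Lemma infinite_halves (T : pointedType) (S : set T) : ~ finite_set S ->
  exists S1 S2, [/\ S1 `<=` S, S2 `<=` S, S1 `&` S2 = set0,
    ~ finite_set S1 & ~ finite_set S2].
Proof.
move/infiniteP/pcard_leP => -[f].
have fI : injective f by move=> x y; apply: (@inj _ _ _ f); rewrite inE.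
have fS n : S (f n) by apply: (@funS _ _ _ _ f).
have inf (g : nat -> nat) : injective g -> ~ finite_set [set f (g n) | n in setT].
  move=> gI /(finite_preimage (f := f \o g)) fin; apply: infinite_nat.
  by apply: sub_finite_set (fin _) => [n _|]; [exists n|move=> x y _ _ /fI/gI].
exists [set f n.*2 | n in setT], [set f n.*2.+1 | n in setT]; split.
- by move=> _ [n _ <-].
- by move=> _ [n _ <-].
- apply/seteqP; split=> // _ [[n _ <-] [m _ /fI/(congr1 odd)]].
  by rewrite /= !odd_double.
- by apply: inf => m n /double_inj.
- by apply: (inf (fun n => n.*2.+1)) => m n [] /double_inj.
Qed.

(** Two tangles are produced, since a single one would not contradict a one-point remainder. They
    differ because their ultrafilters live on disjoint infinite sets of components of the same
    [G - X]. *)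
Lemma two_ultra_tangles : ~ tough G ->
  exists t1 t2 : tangles G, t1 <> t2 /\
    forall w, end_tangle w <> t1 /\ end_tangle w <> t2.
Proof.
move=> /existsNP[X /not_implyP[finX infX]].
have [S1 [S2 [S1X S2X S12 inf1 inf2]]] := infinite_halves infX.
have [F1 [U1 F1S free1]] := free_ultrafilter inf1.
have [F2 [U2 F2S free2]] := free_ultrafilter inf2.
have FF1 : ProperFilter F1 := ultra_proper.
have FF2 : ProperFilter F2 := ultra_proper.
have F1X : F1 (components X) by exact: filterS F1S.
have F2X : F2 (components X) by exact: filterS F2S.
exists (ultra_tangle U1 F1X free1), (ultra_tangle U2 F2X free2); split.
  move=> E; have := ultra_tangle_vertices_of U1 F1X free1 finX S1X.
  rewrite E => /iffRL/(_ F1S)/(ultra_tangle_vertices_of U2 F2X free2 finX S1X) h.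
  by have [x xI] := filter_ex (filterI h F2S); rewrite S12 in xI.
by move=> w; split; exact: ultra_tangle_not_end.
Qed.

End UltrafilterTangles.

(** * The topology of the end space *)

Section Subbase.

(** Reduces the description of neighbourhoods of a point to a check on subbasic sets; the normal
    forms at vertices, inner points and ends are all obtained this way. The first premise is what
    [open] unfolds to in a topology generated by a subbase. *)
Lemma subbase_ind (T : Type) (S : set (set T)) (U : set T) (x : T)
  (Q : set T -> Prop) :
  (exists2 D', D' `<=` finI_from S id & \bigcup_(A in D') A = U) -> U x ->
  Q setT -> (forall A B, Q A -> Q B -> Q (A `&` B)) ->
  (forall A B, A `<=` B -> Q A -> Q B) -> (forall A, S A -> A x -> Q A) -> Q U.
Proof.
move=> [D' sD <-] [A0 DA Ax] QT QI Qs QS; have [J JS JA] := sD _ DA.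
apply: (Qs A0); first by move=> y A0y; exists A0.
pose s : seq (set T) := finmap.enum_fset J.
have sP A : A \in s -> S A /\ A x.
  by move=> AJ; split; [exact: set_mem (JS A AJ)|move: Ax; rewrite -JA; exact].
have sA0 : [set y | forall A, A \in s -> A y] `<=` A0 by rewrite -JA => y /= h A /h.
apply: (Qs _ _ sA0); elim: s sP {JA sA0} => [_|A s IH h].
  by apply: (Qs setT) => // y _ A.
have [SA Ax'] := h A (mem_head _ _).
have Qs' := IH (fun B Bs => h B (mem_behead (s := A :: s) Bs)).
apply: (Qs _ _ _ (QI _ _ (QS A SA Ax') Qs')) => y [Ay sy] B /=.
by rewrite inE => /predU1P[->//|/sy].
Qed.

End Subbase.

Section GraphPoints.
Variables (R : realType) (G : graph).
Local Open Scope ring_scope.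

Lemma basic_open_open (U : set (graph_point R G)) : basic_open U -> open U.
Proof.
move=> bU; exists [set U]; last by rewrite bigcup_set1.
by move=> _ ->; exact: (@finI_from1 _ _ (@basic_open R G) id).
Qed.

Lemma half_itv : 0 < (2^-1 : R) < 1.
Proof. by rewrite invr_gt0 ltr0n invf_lt1 ?ltr0n// ltr1n. Qed.

Lemma open_vertex (U : set (graph_point R G)) v : open U -> U (Vertex R v) ->
  exists i, open_star v i `<=` U.
Proof.
move=> oU Uv; pose Q (A : set (graph_point R G)) := exists i, open_star v i `<=` A.
apply: (@subbase_ind _ (@basic_open R G) U (Vertex R v) Q oU Uv).
- by exists (fun=> exist (fun t : R => 0 < t < 1) 2^-1 half_itv).
- move=> A B [i iA] [j jB].
  exists (fun e => if dist_from v e (i e) < dist_from v e (j e) then i e else j e).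
  move=> p [->|[e [t [ve te ->]]]]; first by split; [apply: iA|apply: jB]; left.
  case: ifPn te => [ij ti|]; last rewrite -leNgt => ji tj.
    by split; [apply: iA|apply: jB]; right; exists e, t; split=> //; exact: lt_trans ij.
  by split; [apply: iA|apply: jB]; right; exists e, t; split=> //; exact: lt_le_trans ji.
- by move=> A B AB [i iA]; exists i => p /iA /AB.
- move=> A [[e [a [b ->]]] [t [_ //]]|[v' [i ->]]] [[<-]|[e [t [_ _ //]]]].
  by exists i.
Qed.

Lemma open_inner (U : set (graph_point R G)) e t : open U -> U (Inner e t) ->
  exists a b, a < val t < b /\ open_interval e a b `<=` U.
Proof.
move=> oU Ut; pose Q (A : set (graph_point R G)) :=
  exists a b, a < val t < b /\ open_interval e a b `<=` A.
apply: (@subbase_ind _ (@basic_open R G) U (Inner e t) Q oU Ut).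
- by exists 0, 1; split=> //; case: (t).
- move=> A B [a [b [/andP[at_ tb] abA]]] [c [d [/andP[ct td] cdB]]].
  exists (Num.max a c), (Num.min b d); split.
    by rewrite gt_max lt_min at_ tb ct td.
  move=> p [s [+ ->]]; rewrite gt_max lt_min => /andP[/andP[as_ cs] /andP[sb sd]].
  by split; [apply: abA|apply: cdB]; exists s; split=> //; apply/andP.
- by move=> A B AB [a [b [h abA]]]; exists a, b; split=> // p /abA /AB.
- move=> A [[e' [a [b ->]]] [t' [h E]]|[v [i ->]]].
    by case: E => ee tt; subst e' t'; exists a, b; split=> // p.
  move=> [//|[e' [t' [ve + E]]]]; case: E => ee tt; subst e' t'.
  rewrite /dist_from; case: ifPn => vs ti.
    (* On the edge [e] the star is an interval reaching up to one endpoint; [val t - 1] is negative,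
       and [val t + 1] in the other orientation exceeds 1, so these bounds cut off nothing. *)
    exists (val t - 1), (val (i e)); split; first by rewrite ltrBlDr ltrDl ltr01.
    move=> p [s [/andP[_ h] ->]]; right; exists e, s; split=> //.
    by rewrite /dist_from vs.
  exists (val (i e)), (val t + 1); split.
    by rewrite ltrDl ltr01 andbT; move: ti; rewrite ltrD2l ltrN2.
  move=> p [s [/andP[h _] ->]]; right; exists e, s; split=> //.
  by rewrite /dist_from (negbTE vs) ltrD2l ltrN2.
Qed.

Lemma open_edge e : open [set @Inner R G e t | t in setT].
Proof.
rewrite (_ : [set _ | _ in _] = open_interval e 0 1).
  by apply: basic_open_open; left; exists e, 0, 1.
by apply/seteqP; split=> [_ [t _ <-]|_ [t [_ ->]]]; exists t => //; split=> //; case: t.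
Qed.

End GraphPoints.

Lemma ultra_bigcup (T I : Type) (F : set_system T) (J : set I) (A : I -> set T) :
  UltraFilter F -> finite_set J -> F (\bigcup_(i in J) A i) ->
  exists2 i, J i & F (A i).
Proof.
move=> ultraF finJ; have FF : ProperFilter F := ultra_proper.
have /finite_seqP[s sE] : finite_set (J : set {classic I}) := finJ.
rewrite sE; elim: s {sE} => [/filter_ex[_ []//]|i s IH FU].
have [Fi|Fi] := in_ultra_setVsetC (A i) ultraF.
  by exists i => //=; exact: mem_head.
have [|j js Fj] := IH; last by exists j => //=; rewrite inE js orbT.
apply: filterS (filterI FU Fi) => p [[j /=] + + nA].
by rewrite inE => /predU1P[->//|js Aj]; exists j.
Qed.

Section EndSpace.
Variables (R : realType) (G : graph).
Implicit Types (X Y A B C D : set G) (w : ends G) (v : G) (S : set (end_space R G)).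

Lemma edge_at (e : edge G) v : sval e v -> exists2 u, adj v u & sval e = [set u; v].
Proof.
have [x [y [xy ->]]] := svalP e.
by move=> [->|->]; [exists y; rewrite // setUC|exists x; rewrite //; exact: adj_sym].
Qed.

Lemma closed_off_component_sub X Z A C x : closed_off X A -> X `<=` Z ->
  components Z C -> C x -> A x -> C `<=` A.
Proof.
move=> [AX Aadj] XZ cC Cx Ax y /(component_linked cC Cx)/clos_rt_rtn1_iff.
elim=> // a b [Ca Cb ab] _ Aa; have [//|Xb] := Aadj _ _ Aa ab.
by case: (component_disjoint cC Cb); exact: XZ.
Qed.

Definition tails_in w A : Prop := forall r, sval w r -> has_tail_in r A.

Lemma tails_in_end_comp X w : finite_set X -> tails_in w (end_comp X w).
Proof. by move=> finX; exact: (end_compP w finX).2. Qed.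

Arguments tails_in_end_comp {X} w _ r _.

Lemma tails_inI w A B : tails_in w A -> tails_in w B -> A `&` B !=set0.
Proof.
move=> wA wB; have [r wr] := end_ray w.
exact: has_tail_ex (has_tailI (wA r wr) (wB r wr)).
Qed.

Lemma tails_in_sub w A B : tails_in w A -> A `<=` B -> tails_in w B.
Proof. by move=> wA AB r /wA/has_tail_sub; apply. Qed.

Lemma tails_in_closed_off X Z A w : finite_set Z -> closed_off X A -> X `<=` Z ->
  tails_in w A -> end_comp Z w `<=` A.
Proof.
move=> finZ AX XZ wA; have wE := tails_in_end_comp w finZ.
have [x [Ex Ax]] := tails_inI wE wA.
exact: closed_off_component_sub AX XZ (end_comp_component w finZ) Ex Ax.
Qed.

Lemma tails_in_vertices_of X Cs w : finite_set X -> Cs `<=` components X ->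
  tails_in w (vertices_of Cs) <-> Cs (end_comp X w).
Proof.
move=> finX CsX; split=> [wV|CsE].
  have [x [Ex Vx]] := tails_inI (tails_in_end_comp w finX) wV.
  exact: vertices_of_component CsX (end_comp_component w finX) Ex Vx.
by apply: tails_in_sub (tails_in_end_comp w finX) _ => x Ex; exists (end_comp X w).
Qed.

(* For a set [Cs] of components of [G - X], the basic open set of the paper is
   [crude_of (hull (vertices_of Cs))], see [cone_crude_of]. *)
Definition hull A : set (end_space R G) :=
  [set p | match p with
    | inl (Vertex v) => A v
    | inl (Inner _ _) => False
    | inr w => tails_in w A
    end].

(** Spreads a set of vertices and ends over the incident edges; inner points that [S] itself may
    contain are discarded, so the result is always crude. *)
Definition crude_of S : set (end_space R G) :=
  [set p | match p with
    | inl (Inner e _) => exists2 v, sval e v & S (inl (Vertex R v))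
    | _ => S p
    end].

Lemma crude_ofS S S' : S `<=` S' -> crude_of S `<=` crude_of S'.
Proof. by move=> SS [[v|e t]|w] /=; try exact: SS; move=> [v ve /SS]; exists v. Qed.

Lemma hullT : hull setT = ~` @inner_set R G.
Proof.
apply/seteqP; split=> [[[v|e t]|w] //= _|[[v|e t]|w]] //=.
- by move=> [_ [e [t [_ ->]]]].
- by move=> [].
- by case; exists (Inner e t) => //; exists e, t.
- by move=> _ r _; exists 0%N.
Qed.

Lemma hullS A B : A `<=` B -> hull A `<=` hull B.
Proof. by move=> AB [[v|e t]|w] //=; [exact: AB|move/tails_in_sub; apply]. Qed.

Lemma hull_sub A : hull A `<=` ~` @inner_set R G.
Proof. by rewrite -hullT; exact: hullS. Qed.

Lemma hullI A B p : hull A p -> hull B p -> A `&` B !=set0.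
Proof. by case: p => [[v|e t]|w] //=; [exists v|exact: tails_inI]. Qed.

Lemma hull_crude_of A : hull A `<=` crude_of (hull A).
Proof. by move=> [[v|e t]|w]. Qed.

(** An edge with one endpoint in a component of [G - X] has the other one in the same component or
    in [X]; so the edges inside the components and those from [X] to them are exactly the edges with
    an endpoint in a component. *)
Lemma cone_crude_of X Cs : finite_set X -> Cs `<=` components X ->
  inl @` cone R X Cs `|` inr @` [set w | Cs (end_comp X w)] =
  crude_of (hull (vertices_of Cs)).
Proof.
move=> finX CsX; apply/seteqP; split.
- move=> _ [[[v|e t] pC <-]|[w CsE <-]] /=.
  + by case: pC => [|[e [t []]]//].
  + case: pC => [[C CsC eC]|[e' [t' [[x [y [Xx Vy eE]]] [ee _]]]]]; last subst e'.
      have [x [y [xy eE]]] := svalP e; exists x; first by rewrite eE; left.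
      by exists C => //; apply: eC; rewrite eE; left.
    by exists y => //; rewrite eE; right.
  + exact/(tails_in_vertices_of _ finX CsX).
- move=> [[v Vv|e t [v ve [C CsC Cv]]]|w].
  + by left; exists (Vertex R v) => //; left.
  + left; exists (Inner e t) => //; have [u vu eE] := edge_at ve.
    have [Xu|Xu] := pselect (X u).
      by right; exists e, t; split=> //; exists u, v; split=> //; exists C.
    left; exists C => // z; rewrite eE => -[->|->//].
    exact: component_adj (CsX C CsC) Cv vu Xu.
  + by move=> /(tails_in_vertices_of _ finX CsX) CsE; right; exists w.
Qed.

End EndSpace.
Arguments hull R {G} A.

Section EndSpaceTopology.
Variables (R : realType) (G : graph).
Local Notation Y := (end_space R G).
Local Notation Y0 := (~` @inner_set R G).
Implicit Types (X A B C D : set G) (w : ends G) (v : G) (S O : set Y).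

Lemma openP_sub (T : topologicalType) (O : set T) :
  (forall p, O p -> exists U, [/\ open U, U p & U `<=` O]) -> open O.
Proof.
by move=> h; rewrite openE => p /h[U [oU Up UO]]; rewrite /interior nbhsE; exists U.
Qed.

Lemma end_space_subbase S : @end_space_open R G S -> open S.
Proof.
move=> bS; exists [set S]; last by rewrite bigcup_set1.
by move=> _ ->; exact: (@finI_from1 _ _ (@end_space_open R G) id).
Qed.

Lemma open_inl (U : set (graph_point R G)) : open U -> open (inl @` U : set Y).
Proof. by move=> oU; apply: end_space_subbase; left; exists U. Qed.

(** A crude set contains with each vertex all incident open edges, and with each inner point its
    whole open edge. Openness of such sets is therefore only an issue at the ends. *)
Lemma crude_of_graph S : open (inl @^-1` crude_of S).
Proof.
apply: openP_sub => -[v Sv|e t [v ve Sv]]; last first.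
  exists [set Inner e t | t in setT]; split; [exact: open_edge|by exists t|].
  by move=> _ [s _ <-]; exists v.
pose half := exist (fun t : R => (0 < t < 1)%R) _ (half_itv R).
exists (open_star v (fun=> half)); split.
- by apply: basic_open_open; right; exists v, (fun=> half).
- by left.
- by move=> _ [->//|[e [t [ve _ ->]]]]; exists v.
Qed.

(** A single basic set suffices at an end, because those belonging to [X] and [X'] both contain the
    one belonging to their union. *)
Lemma open_end_space S : open S <->
  open (inl @^-1` S) /\
  forall w, S (inr w) -> exists2 X, finite_set X & crude_of (hull R (end_comp X w)) `<=` S.
Proof.
split=> [oS|[oG oE]].
- split=> [|w Sw].
  + rewrite openE => p Sp; rewrite /interior.
    pose Q (S : set Y) := nbhs p (inl @^-1` S : set (graph_point R G)).
    apply: (@subbase_ind _ (@end_space_open R G) S (inl p) Q oS Sp).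
    * exact: filterT.
    * by move=> A B; exact: filterI.
    * by move=> A B AB; apply: filterS => q /AB.
    * move=> _ [[U oU ->] [q Uq [qp]]|[X [Cs [finX CsX ->]]]].
        by subst q; apply: filterS (open_nbhs_nbhs (conj oU Uq)) => z Uz; exists z.
      rewrite cone_crude_of // => Sp'; apply: open_nbhs_nbhs; split=> //.
      exact: crude_of_graph.
  + pose Q (S : set Y) := exists2 X, finite_set X & crude_of (hull R (end_comp X w)) `<=` S.
    apply: (@subbase_ind _ (@end_space_open R G) S (inr w) Q oS Sw).
    * by exists set0.
    * move=> A B [X finX XA] [X' finX' XB]; exists (X `|` X').
        by rewrite finite_setU.
      have finXX : finite_set (X `|` X') by rewrite finite_setU.
      move=> p pX; split; [apply: XA|apply: XB]; apply: crude_ofS pX; apply: hullS.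
        by apply: end_comp_mono => // x; left.
      by apply: end_comp_mono => // x; right.
    * by move=> A B AB [X finX XA]; exists X => // p /XA /AB.
    * move=> _ [[U oU ->] [q _ //]|[X [Cs [finX CsX ->]]]].
      rewrite cone_crude_of // => /(tails_in_vertices_of _ finX CsX) CsE.
      exists X => //; apply/crude_ofS/hullS => x Ex; by exists (end_comp X w).
- apply: openP_sub => -[p Sp|w /oE[X finX XS]].
    exists (inl @` (inl @^-1` S)); split; [exact: open_inl|by exists p|].
    by move=> _ [q Sq <-].
  exists (crude_of (hull R (end_comp X w))); split=> //; last first.
    exact: tails_in_end_comp.
  apply: end_space_subbase; right; exists X, [set end_comp X w].
  have sub : [set end_comp X w] `<=` components X by move=> _ ->; exact: end_comp_component.
  split=> //; rewrite cone_crude_of // /vertices_of bigcup_set1 //.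
Qed.

Lemma open_crude_of S :
  (forall w, S (inr w) -> exists2 X, finite_set X & hull R (end_comp X w) `<=` S) ->
  open (crude_of S).
Proof.
move=> h; apply/open_end_space; split; first exact: crude_of_graph.
by move=> w /h[X finX XS]; exists X => //; exact: crude_ofS.
Qed.

Lemma open_hull X A : finite_set X -> closed_off X A -> open (crude_of (hull R A)).
Proof.
move=> finX AX; apply: open_crude_of => w wA; exists X => //.
exact/hullS/(tails_in_closed_off finX AX _ wA).
Qed.

Lemma open_isolated v : exists O, [/\ open O, O (inl (Vertex R v)) &
  O `&` Y0 `<=` [set inl (Vertex R v)]].
Proof.
pose half := exist (fun t : R => (0 < t < 1)%R) _ (half_itv R).
exists (inl @` open_star v (fun=> half)); split.
- by apply/open_inl/basic_open_open; right; exists v, (fun=> half).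
- by exists (Vertex R v) => //; left.
- move=> _ [[_ [->|[e [t [_ _ ->]]]] <-] ni]; first by [].
  by case: ni; exists (Inner e t) => //; exists e, t.
Qed.

(** Hausdorffness of the subspace [Z], phrased with open sets of the ambient space: they may overlap
    outside [Z], which happens along edges. *)
Definition separated_in (T : topologicalType) (Z : set T) : Prop :=
  forall x y, Z x -> Z y -> x <> y ->
    exists U V, [/\ open U, open V, U x, V y & U `&` V `&` Z = set0].

Lemma separated_end_space : separated_in Y0.
Proof.
have swap x y :
    (exists U V : set Y, [/\ open U, open V, U x, V y & U `&` V `&` Y0 = set0]) ->
    exists U V : set Y, [/\ open U, open V, U y, V x & U `&` V `&` Y0 = set0].
  by move=> [U [V [oU oV Ux Vy UV]]]; exists V, U; rewrite (setIC V).
have vw v w : exists U V : set Y,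
    [/\ open U, open V, U (inl (Vertex R v)), V (inr w) & U `&` V `&` Y0 = set0].
  have [N [oN Nv Ns]] := open_isolated v.
  have cv := end_comp_component w (finite_set1 v).
  exists N, (crude_of (hull R (end_comp [set v] w))); split=> //.
  - exact: open_hull (finite_set1 v) (closed_off_component cv).
  - exact/tails_in_end_comp/finite_set1.
  - apply/seteqP; split=> // p [[Np pE] Yp].
    have pv := Ns p (conj Np Yp); rewrite pv in pE.
    exact: component_disjoint cv pE _.
move=> [[v|e t]|w] [[v'|e' t']|w'] // Yx Yy xy.
- have [N [oN Nv Ns]] := open_isolated v.
  have [N' [oN' Nv' Ns']] := open_isolated v'.
  exists N, N'; split=> //; apply/seteqP; split=> // p [[Np Np'] Yp].
  by apply: xy; rewrite -(Ns p (conj Np Yp)); exact: (Ns' p (conj Np' Yp)).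
- by case: Yy; exists (Inner e' t') => //; exists e', t'.
- by case: Yx; exists (Inner e t) => //; exists e, t.
- by case: Yx; exists (Inner e t) => //; exists e, t.
- by case: Yx; exists (Inner e t) => //; exists e, t.
- exact/swap/vw.
- by case: Yy; exists (Inner e' t') => //; exists e', t'.
- have [X [finX XE]] : exists X, finite_set X /\ end_comp X w <> end_comp X w'.
    apply: contrapT => /forallNP h; apply: xy; congr inr; apply: ends_eq => X finX.
    by apply: contrapT => E; apply: (h X).
  have cE := end_comp_component w finX; have cE' := end_comp_component w' finX.
  exists (crude_of (hull R (end_comp X w))), (crude_of (hull R (end_comp X w'))); split.
  + exact: open_hull finX (closed_off_component cE).
  + exact: open_hull finX (closed_off_component cE').
  + exact: tails_in_end_comp.
  + exact: tails_in_end_comp.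
  + apply/seteqP; split=> // -[[v|e t]|u] [[/= h1 h2] Yp].
    * exact/XE/(components_eq cE cE' h1 h2).
    * by apply: Yp; exists (Inner e t) => //; exists e, t.
    * have [z [z1 z2]] := tails_inI h1 h2.
      exact/XE/(components_eq cE cE' z1 z2).
Qed.

End EndSpaceTopology.

(** * Toughness and compactness *)

Section Compactness.
Variables (R : realType) (G : graph).
Local Notation Y := (end_space R G).
Local Notation Y0 := (~` @inner_set R G).
Implicit Types (X A B C D : set G) (w : ends G) (v : G) (S : set Y).

Lemma compact_hull X A : finite_set X -> closed_off X A -> tough_in A ->
  compact (hull R A).
Proof.
move=> finX AX tA; rewrite compact_ultra => F ultraF FA.
have FF : ProperFilter F := ultra_proper.
have [[v Fv]|nF] := pselect (exists v, F [set inl (Vertex R v)]).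
  exists (inl (Vertex R v)); split.
    by have [_ [-> ]] := filter_ex (filterI Fv FA).
  move=> B /nbhs_singleton Bv; apply: filterS Fv => _ -> //.
(* The vertices of [Z] and the hulls of the finitely many components of [A] minus [Z] cover the hull
   of [A]. The ultrafilter contains one of these pieces, and by [nF] it is not a single vertex. *)
have cut Z : finite_set Z -> exists C, components Z C /\ F (hull R C).
  move=> finZ; have finXZ : finite_set (X `|` Z) by rewrite finite_setU.
  pose P (i : G + set G) : set Y := match i with
    inl v => [set inl (Vertex R v)] | inr D => hull R D end.
  have finJ : finite_set (inl @` Z `|` inr @` classes (A `\` Z) : set (G + set G)).
    by rewrite finite_setU; split; apply: finite_image => //; exact: tA.
  have [|i [[z Zz <-] /= Fz|[D + <-] /= FD]] := @ultra_bigcup _ _ F _ P ultraF finJ.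
  - apply: filterS FA => -[[v|//]|w] /= hA.
    + have [Zv|Zv] := pselect (Z v); first by exists (inl v) => //; left; exists v.
      have XZv : ~ (X `|` Z) v.
        by case=> // Xv; have : (A `&` X) v by []; rewrite (proj1 AX).
      have [D cD Dv] := mem_component XZv.
      exists (inr D) => //; right; exists D => //; rewrite (closed_off_classes Z AX).
      by split=> //; apply: (closed_off_component_sub AX _ cD Dv hA) => z; left.
    + exists (inr (end_comp (X `|` Z) w)); last exact: tails_in_end_comp.
      right; exists (end_comp (X `|` Z) w) => //; rewrite (closed_off_classes Z AX).
      split; first exact: end_comp_component.
      by apply: (tails_in_closed_off finXZ AX _ hA) => z; left.
  - by case: nF; exists z.
  - rewrite (closed_off_classes Z AX) => -[cD _].
    have [x Dx] := component_ex cD.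
    have Zx : ~ Z x by move=> Zx; apply: (component_disjoint cD Dx); right.
    have [C cC Cx] := mem_component Zx.
    exists C; split=> //; apply: filterS FD; apply: hullS.
    by apply: (component_mono _ cC cD Cx Dx) => z; right.
have /choice[c cP] : forall Z, exists C, finite_set Z -> components Z C /\ F (hull R C).
  move=> Z; have [/cut[C]|] := pselect (finite_set Z); first by exists C.
  by exists set0.
have cc Z (finZ : finite_set Z) : components Z (c Z) by case: (cP Z finZ).
have Fc Z (finZ : finite_set Z) : F (hull R (c Z)) by case: (cP Z finZ).
have c_mono Z Z' : finite_set Z' -> Z `<=` Z' -> c Z' `<=` c Z.
  move=> finZ' ZZ; have finZ := sub_finite_set ZZ finZ'.
  have [p [p1 p2]] := filter_ex (filterI (Fc Z finZ) (Fc Z' finZ')).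
  have [x [x1 x2]] := hullI p1 p2.
  exact: component_mono ZZ (cc Z finZ) (cc Z' finZ') x1 x2.
have [w wE] := direction_end cc c_mono.
exists (inr w); split.
  have [p [p1 p2]] := filter_ex (filterI (Fc X finX) FA).
  have [x [x1 x2]] := hullI p1 p2.
  apply: (@tails_in_sub _ _ (c X)); first by rewrite -wE //; exact: tails_in_end_comp.
  exact: closed_off_component_sub AX (fun z Xz => Xz) (cc X finX) x1 x2.
move=> B; rewrite /= nbhsE => -[U [oU Uw] UB].
have [_ /(_ w Uw)[Z finZ ZU]] := (open_end_space U).1 oU.
apply: filterS (Fc Z finZ) => p cp; apply/UB/ZU; rewrite wE //.
exact: hull_crude_of.
Qed.

(** From infinitely many components left in [A] one vertex each is chosen. The chosen vertices
    cannot accumulate at a vertex, since vertices are isolated in the skeleton, nor at an end, since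
    the end has a neighbourhood whose vertices lie in a single component. *)
Lemma tough_in_compact X A : finite_set X -> closed_off X A ->
  compact (hull R A) -> tough_in A.
Proof.
move=> finX AX cA Z finZ; apply: contrapT => infC.
have finXZ : finite_set (X `|` Z) by rewrite finite_setU.
pose J := classes (A `\` Z).
have JP D : J D -> components (X `|` Z) D /\ D `<=` A by rewrite /J (closed_off_classes Z AX).
(* A value is needed for every set [D], although [G] has no distinguished vertex; [None] serves as
   default outside [J]. *)
have /choice[f fP] : forall D, exists x : option G, J D -> exists2 v, x = Some v & D v.
  move=> D; have [/JP[cD _]|] := pselect (J D); last by exists None.
  by have [x Dx] := component_ex cD; exists (Some x) => _; exists x.
(* The filter of the sets that contain all but finitely many of the chosen vertices. *)
pose F : set_system Y := [set P |
  finite_set [set D | J D /\ exists2 v, D v & f D = Some v /\ ~ P (inl (Vertex R v))]].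
have FF : ProperFilter F.
  split=> [fin|].
    apply: infC; apply: sub_finite_set fin => D JD; split=> //.
    by have [v fv Dv] := fP D JD; exists v => //; split=> // -[].
  split.
  - by apply: (@sub_finite_set _ _ set0) => // D [_ [v _ [_ []]]].
  - move=> P Q FP FQ; have := conj FP FQ; rewrite /F /= -finite_setU.
    apply: sub_finite_set => D [JD [v Dv [fv /not_andP[nP|nQ]]]].
      by left; split=> //; exists v.
    by right; split=> //; exists v.
  - move=> P Q PQ; apply: sub_finite_set => D [JD [v Dv [fv nQ]]].
    by split=> //; exists v => //; split=> // /PQ.
have FA : F (hull R A).
  apply: (@sub_finite_set _ _ set0) => // D [/JP[_ DA] [v Dv [_]]].
  by apply; exact: DA.
have FDn C : components (X `|` Z) C -> F [set p | forall v, p = inl (Vertex R v) -> ~ C v].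
  move=> cC; apply: (@sub_finite_set _ _ [set C]); last exact: finite_set1.
  move=> D [/JP[cD _] [v Dv [_ /existsNP[u /not_implyP[[<-] /contrapT Cv]]]]].
  exact: components_eq cD cC Dv Cv.
have Fvert : F [set p | exists D v, [/\ J D, D v & p = inl (Vertex R v)]].
  by apply: (@sub_finite_set _ _ set0) => // D [JD [v Dv [_ []]]]; exists D, v.
have [z [zA cz]] := cA F FF FA; case: z zA cz => [[v|//]|w] /= zA cz.
- have [U [oU Uv Us]] := open_isolated R v.
  have nU : nbhs (inl (Vertex R v) : Y) U by apply: open_nbhs_nbhs.
  have [Zv|Zv] := pselect ((X `|` Z) v).
    have [p [[D [u [/JP[cD _] Du pE]]] Up]] := cz _ _ Fvert nU.
    have : [set inl (Vertex R v) : Y] p.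
      by apply: Us; split=> //; rewrite pE => -[_ [e [t [_ ->]]]].
    rewrite pE => -[uv]; apply: (component_disjoint cD Du); by rewrite uv.
  have [C cC Cv] := mem_component Zv.
  have [p [[[D [u [/JP[cD _] Du pE]]] pC] Up]] := cz _ _ (filterI Fvert (FDn C cC)) nU.
  have : [set inl (Vertex R v) : Y] p.
    by apply: Us; split=> //; rewrite pE => -[_ [e [t [_ ->]]]].
  by move=> /pC.
- have cE := end_comp_component w finXZ.
  have nE : nbhs (inr w : Y) (crude_of (hull R (end_comp (X `|` Z) w))).
    apply: open_nbhs_nbhs; split; last exact: tails_in_end_comp.
    exact: open_hull finXZ (closed_off_component cE).
  have [p [[[D [u [JD Du pE]]] pC] Up]] := cz _ _ (filterI Fvert (FDn _ cE)) nE.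
  by apply: (pC u pE); move: Up; rewrite pE.
Qed.

Lemma compact_Y0 : compact Y0 <-> tough G.
Proof.
rewrite -hullT; split=> [cY|tG].
  apply/tough_inT; exact: tough_in_compact (@finite_set0 G) (closed_offT G) cY.
by apply: compact_hull (@finite_set0 G) (closed_offT G) _; apply/tough_inT.
Qed.

(** At an end, the hull of a tough component is open relative to the skeleton and compact at once,
    so it is its own compact neighbourhood. *)
Lemma end_tough_locally_compact : end_tough G -> forall y, Y0 y ->
  exists N K, [/\ open N, N y, compact K, K `<=` Y0 & N `&` Y0 `<=` K].
Proof.
move=> tE [[v|e t]|w] Yy.
- have [N [oN Nv Ns]] := open_isolated R v.
  exists N, [set inl (Vertex R v)]; split=> //; first exact: compact_set1.
  by move=> _ ->.
- by case: Yy; exists (Inner e t) => //; exists e, t.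
- have [X finX /tough_induced tC] := tE w.
  have cX := closed_off_component (end_comp_component w finX).
  exists (crude_of (hull R (end_comp X w))), (hull R (end_comp X w)); split.
  + exact: open_hull cX.
  + exact: tails_in_end_comp.
  + exact: compact_hull cX tC.
  + exact: hull_sub.
  + move=> [[v|e t]|u] [//= _ []]; by exists (Inner e t) => //; exists e, t.
Qed.

End Compactness.

(** * Omega-compactifications *)

Section CompactSeparated.
Variable T : topologicalType.
Implicit Types (Z K U V W : set T).

(** Otherwise the traces on [K] of the neighbourhoods of [x] generate a proper filter, and a cluster
    point of it in [K] could not be separated from [x]. *)
Lemma compact_separate Z K x : separated_in Z -> compact K -> K `<=` Z ->
  Z x -> ~ K x -> exists W, [/\ open W, W x & W `&` K = set0].
Proof.
move=> sepZ cK KZ Zx Kx; apply: contrapT => /forallNP h.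
pose F := filter_from (nbhs x) (fun W => W `&` K).
have FF : ProperFilter F.
  apply: filter_from_proper; last first.
    move=> W; rewrite nbhsE => -[U [oU Ux] UW]; apply: contrapT => /set0P/negP.
    rewrite negbK => /eqP W0; apply: (h U); split=> //; apply/seteqP; split=> // p [/UW Wp Kp].
    by rewrite -W0.
  apply: filter_from_filter; first by exists setT; exact: filterT.
  by move=> A B Ax Bx; exists (A `&` B); [exact: filterI|move=> p [[]]].
have FK : F K by exists setT; [exact: filterT|move=> p []].
have [k [Kk ck]] := cK F FF FK.
have [|U [V [oU oV Ux Vk UV]]] := sepZ x k Zx (KZ k Kk).
  by move=> xk; rewrite xk in Kx.
have FU : F (U `&` K) by exists U => //; exact: open_nbhs_nbhs.
have [p [[Up Kp] Vp]] := ck _ _ FU (open_nbhs_nbhs (conj oV Vk)).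
have : (U `&` V `&` Z) p by split=> //; exact: KZ.
by rewrite UV.
Qed.

Lemma closed_compactD K W : compact K -> open W -> compact (K `\` W).
Proof.
by move=> cK oW; rewrite setDE; apply: (compact_closedI cK); exact: open_closedC.
Qed.

End CompactSeparated.

Section Embedding.
Variables (T K : topologicalType) (i : T -> K).
Hypothesis iE : embedding i.

Lemma embedding_open (U : set T) : open U -> exists W, [/\ open W & forall x, W (i x) <-> U x].
Proof.
move=> oU; have [iI _ /(_ U oU)[W oW WE]] := iE.
exists W; split=> // x; split=> [Wx|Ux].
  by have : (W `&` range i) (i x) by []; rewrite -WE => -[y Uy /iI <-].
have : (W `&` range i) (i x) by rewrite -WE; exists x.
by case.
Qed.

Lemma embedding_compact A : compact (i @` A) -> compact A.
Proof.
move=> cA F FF FA.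
have FiA B : F B -> (i @ F) (i @` B).
  move=> FB; change (F (i @^-1` (i @` B))).
  by apply: filterS FB => x Bx; exists x.
have [_ [[a Aa <-] ca]] := cA (i @ F) _ (FiA A FA).
exists a; split=> // B U FB; rewrite nbhsE => -[V [oV Va] VU].
have [W [oW WV]] := embedding_open oV.
have [_ [[b Bb <-] Wb]] := ca _ _ (FiA B FB) (open_nbhs_nbhs (conj oW ((WV a).2 Va))).
by exists b; split=> //; apply: VU; exact/WV.
Qed.

Lemma compact_embedding A : compact A -> compact (i @` A).
Proof.
move=> cA; apply: continuous_compact => //; apply: continuous_subspaceT.
by case: iE.
Qed.

End Embedding.

Lemma set_val_embedding (T : topologicalType) (Z : set T) :
  embedding (set_val : Z -> T).
Proof.
split.
- exact: val_inj.
- exact: initial_continuous.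
- move=> U [V oV <-]; exists V => //; apply/seteqP; split.
    by move=> _ [x Vx <-]; split=> //; exists x.
  by move=> p [Vp [x _ xp]]; exists x => //; change (V (set_val x)); rewrite xp.
Qed.

Lemma range_set_val (T : Type) (Z : set T) : [set set_val x | x in [set: Z]] = Z.
Proof.
apply/seteqP; split=> [_ [x _ <-]|z Zz]; first exact: set_valP.
by exists (exist _ z (mem_set Zz)).
Qed.

Section OmegaCompactification.
Variables (R : realType) (G : graph).
Local Notation Y := (end_space R G).
Local Notation inner := (@inner_set R G).
Local Notation Y0 := (~` inner).
Implicit Types (a b : extension Y).

(** Besides vertices and ends this contains the whole remainder. *)
Definition skeleton a : set a := ~` (ext_map a @` inner).
Arguments skeleton a _ : clear implicits.

(** Replaces the compactification between subtypes by conditions on subsets of [a]. Density of the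
    full image follows from density in the skeleton, because all other points are images of inner
    edge points. *)
Lemma omega_compactificationP a : omega_compactification a <->
  [/\ compact [set: a], embedding (ext_map a), compact (skeleton a),
      separated_in (skeleton a) &
      forall W z, open W -> W z -> skeleton a z -> exists2 y, Y0 y & W (ext_map a y)].
Proof.
split=> [[[ca ea da] [h [hE [cK eK dK] haus]]]|[ca ea cZ sZ dZ]].
  split=> //.
  - rewrite -[skeleton a]range_set_val; 
    exact: (@compact_embedding _ _ set_val (set_val_embedding _) setT cK).
  - move=> x y Zx Zy xy; move: haus; rewrite open_hausdorff.
    move=> /(_ (exist _ x (mem_set Zx)) (exist _ y (mem_set Zy))).
    case=> [|[A B]]; first by apply/eqP => -[].
    move=> /= [/set_mem Ax /set_mem By] [[U oU UA] [V oV VB] /eqP AB].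
    exists U, V; split=> //; first by move: Ax; rewrite -UA.
      by move: By; rewrite -VB.
    apply/seteqP; split=> // z [[Uz Vz] Zz].
    have : (A `&` B) (exist _ z (mem_set Zz)) by rewrite -UA -VB.
    by rewrite AB.
  - move=> W z oW Wz Zz.
    have [||p [Wp [y _ hy]]] := dK (set_val @^-1` W).
    + by exists (exist _ z (mem_set Zz)).
    + by exists W.
    + exists (val y); first exact: set_valP.
      by move: Wp; rewrite -hy -hE.
have [iI ic io] := ea.
have hP (y : Y0) : skeleton a (ext_map a (val y)).
  by move=> [x xI /iI xy]; apply: (set_valP y); rewrite /= -xy.
pose h (y : Y0) : skeleton a := exist _ (ext_map a (val y)) (mem_set (hP y)).
split.
  split=> // W [p Wp] oW; have [[x xI xp]|Zp] := pselect ((ext_map a @` inner) p).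
    by exists p; split=> //; exists x.
  by have [y _ Wy] := dZ W p oW Wp Zp; exists (ext_map a y); split=> //; exists y.
exists h; split=> //.
- split.
  + apply: (embedding_compact (set_val_embedding _)).
    by rewrite range_set_val.
  + split.
    * move=> x y xy; apply: val_inj; apply: iI.
      exact: (congr1 set_val xy).
    * apply: (continuous_comp_initial (w := set_val)).
      apply/continuousP => U oU; exists (ext_map a @^-1` U) => //.
      by move/continuousP: ic; exact.
    * move=> _ [V oV <-]; have [W [oW WV]] := embedding_open ea oV.
      exists (set_val @^-1` W); first by exists W.
      apply/seteqP; split=> [_ [y Vy <-]|p [Wp [y _ hy]]].
        by split; [exact/WV|exists y].
      by exists y => //; move: Wp; rewrite -hy => /WV.
  + move=> W [p Wp] [V oV VW].
    have [|y Yy Vy] := dZ V (set_val p) oV _ (set_valP p); first by move: Wp; rewrite -VW.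
    exists (h (exist _ y (mem_set Yy))); split; first by rewrite -VW.
    by exists (exist _ y (mem_set Yy)).
- rewrite open_hausdorff => x y /eqP xy.
  have [|U [V [oU oV Ux Vy UV]]] := sZ (set_val x) (set_val y) (set_valP x) (set_valP y).
    by move=> E; apply: xy; exact: val_inj.
  exists (set_val @^-1` U, set_val @^-1` V).
    by split; apply: mem_set.
  split; [by exists U|by exists V|apply/eqP/seteqP; split=> // z [/= Uz Vz]].
  have : (U `&` V `&` skeleton a) (set_val z) by split=> //; exact: set_valP.
  by rewrite UV.
Qed.

End OmegaCompactification.
Arguments skeleton {R G} a _.

(** * Compactness from the skeleton *)

Section EdgeCompact.
Import numFieldNormedType.Exports.
Variables (R : realType) (G : graph).
Local Open Scope ring_scope.
Local Notation Y := (end_space R G).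

Lemma edge_srcP (e : edge G) : exists2 u, u <> edge_src e & sval e = [set edge_src e; u].
Proof.
have [y [xy eE]] := svalP (cid (svalP e)); exists y => //.
by move=> yx; apply: (@adj_irrefl G (edge_src e)); rewrite -{2}yx.
Qed.

Definition edge_tgt (e : edge G) : G := sval (cid2 (edge_srcP e)).

Lemma edge_tgt_neq (e : edge G) : edge_tgt e <> edge_src e.
Proof. exact: (s2valP (cid2 (edge_srcP e))). Qed.

Lemma edgeE (e : edge G) : sval e = [set edge_src e; edge_tgt e].
Proof. exact: (s2valP' (cid2 (edge_srcP e))). Qed.

(** Parametrises the closed edge by the unit interval and is constant on either side of it, so that
    continuity can be proved on all of [R]. *)
Definition edge_path (e : edge G) (r : R) : graph_point R G :=
  match pselect (0 < r < 1) with
  | left h => Inner e (exist _ r h)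
  | right _ => if r <= 0 then Vertex R (edge_src e) else Vertex R (edge_tgt e)
  end.

Lemma edge_path_inner (e : edge G) (t : unit_itv R) : edge_path e (val t) = Inner e t.
Proof.
rewrite /edge_path; case: pselect => [h|]; last by case: t.
by congr Inner; apply: val_inj.
Qed.

Lemma edge_path_continuous e : continuous (edge_path e).
Proof.
apply/continuousP => U oU; apply: openP_sub => r /=.
rewrite /edge_path; case: pselect => [h /(open_inner oU)[a [b [/= /andP[ar rb] abU]]]|h].
  exists [set s | (Num.max a 0 < s) && (s < Num.min b 1)]; split.
  - rewrite (_ : [set _ | _] = [set s | Num.max a 0 < s] `&` [set s | s < Num.min b 1]).
      by apply: openI; [exact: open_gt|exact: open_lt].
    by apply/seteqP; split=> s /=; [move=> /andP[]|move=> []] => ? ?; [split|apply/andP].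
  - by case/andP: h => r0 r1; rewrite /= gt_max lt_min ar rb r0 r1.
  - move=> s /=; rewrite gt_max lt_min => /andP[/andP[as_ s0] /andP[sb s1]].
    rewrite /edge_path; case: pselect => [h'|]; last by rewrite s0 s1.
    by apply: abU; exists (exist _ s h'); split=> //=; rewrite as_ sb.
case: ifPn => [r0 /(open_vertex oU)[i iU]|].
  exists [set s | s < val (i e)]; split.
  - exact: open_lt.
  - by rewrite /=; case: (i e) => /= t /andP[t0 _]; exact: le_lt_trans r0 t0.
  - move=> s /= si; rewrite /edge_path; case: pselect => [h'|h'].
      apply: iU; right; exists e, (exist _ s h'); split=> //.
        by rewrite /edges_at /= edgeE; left.
      by rewrite /dist_from asboolT.
    rewrite ifT; first by apply: iU; left.
    rewrite leNgt; apply/negP => s0; apply: h'; rewrite s0 /=.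
    by apply: lt_trans si _; case: (i e) => /= t /andP[].
rewrite -ltNge => r0 /(open_vertex oU)[i iU].
have r1 : 1 <= r by rewrite leNgt; apply/negP => r1; apply: h; rewrite r0.
exists [set s | val (i e) < s]; split.
- exact: open_gt.
- by rewrite /=; case: (i e) => /= t /andP[_ t1]; exact: lt_le_trans t1 r1.
- move=> s /= si; rewrite /edge_path; case: pselect => [h'|h'].
    apply: iU; right; exists e, (exist _ s h'); split=> //.
      by rewrite /edges_at /= edgeE; right.
    rewrite /dist_from asboolF; last exact: edge_tgt_neq.
    by rewrite ltrD2l ltrN2.
  rewrite ifF; first by apply: iU; left.
  apply/negbTE; rewrite -ltNge.
  by apply: lt_trans si; case: (i e) => /= t /andP[].
Qed.

Lemma compact_edge (e : edge G) :
  compact ([set edge_path e r | r in `[0, 1]%classic] : set (graph_point R G)).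
Proof.
apply: continuous_compact; last exact: segment_compact.
by apply: continuous_subspaceT; exact: edge_path_continuous.
Qed.

Lemma inl_continuous : continuous (inl : graph_point R G -> Y).
Proof. by apply/continuousP => U /open_end_space[]. Qed.

(* Along an ultrafilter of inner edge points both endpoints converge in the
   skeleton. A limit that is not a vertex is also a limit of the inner points,
   by crudeness; if both limits are vertices, the ultrafilter lives on one edge. *)
Lemma compact_of_skeleton (T : topologicalType) (i : Y -> T) : embedding i ->
  compact (~` (i @` @inner_set R G)) ->
  (forall z, ~ range i z \/ (exists w, z = i (inr w)) -> forall W, nbhs z W ->
     exists2 W', nbhs z W' & W' `<=` W /\ forall v e t, sval e v ->
       W' (i (inl (Vertex R v))) -> W' (i (inl (Inner e t)))) ->
  compact [set: T].
Proof.
move=> iE; have [iI ic _] := iE.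
set Z := ~` _ => cZ ideal; rewrite compact_ultra => F ultraF _.
have FF : ProperFilter F := ultra_proper.
have [FI|FZ] := in_ultra_setVsetC (i @` @inner_set R G) ultraF; last first.
  move: cZ; rewrite compact_ultra => /(_ F ultraF FZ)[z [_ Fz]]; by exists z.
have [p0 [y0 [q0 [e0 [t0 _]] _] _]] := filter_ex FI.
have /choice[f fP] : forall p, exists et : edge G * unit_itv R,
    (i @` @inner_set R G) p -> p = i (inl (Inner et.1 et.2)).
  move=> p; have [[_ [_ [e [t [_ ->]]] <-] <-]|] := pselect ((i @` @inner_set R G) p).
    by exists (e, t).
  by exists (e0, t0).
apply: contrapT => nconv.
have ends_at (g : edge G -> G) : (forall e, sval e (g e)) ->
    exists x, F [set p | g (f p).1 = x].
  move=> gP; pose h p := i (inl (Vertex R (g (f p).1))).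
  have hZ p : Z (h p) by move=> [_ [q [e [t [_ ->]]] <-] /iI].
  have FhP : ProperFilter (h @ F) by exact: fmap_proper_filter.
  have FhZ : (h @ F) Z by change (F (h @^-1` Z)); apply: filterS FI => p _; exact: hZ.
  have [z [Zz cz]] := cZ (h @ F) FhP FhZ.
  have conv : (~ range i z \/ exists w, z = i (inr w)) -> False.
    move=> zI; apply: nconv; exists z; split=> // W nW.
    have [W' nW' [W'W W'c]] := ideal z zI W nW.
    have [FW|FW] := in_ultra_setVsetC W ultraF => //; exfalso.
    have FW' : (h @ F) (~` W').
      change (F (h @^-1` (~` W'))); apply: filterS (filterI FI FW) => p [pI Wp] hp.
      by apply: Wp; rewrite (fP p pI); apply/W'W/(W'c (g (f p).1)).
    by have [q [nq q']] := cz _ _ FW' nW'.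
  have [[[[v|e t]|w] _ zE]|nz] := pselect (range i z).
  (* The vertex [v] is isolated in the skeleton, so endpoints that cluster at [v] must equal [v] on
     a set of the ultrafilter. *)
  - exists v.
    have [U [oU Uv Us]] := open_isolated R v.
    have [W [oW WU]] := embedding_open iE oU.
    have nW : nbhs z W by rewrite -zE; apply: open_nbhs_nbhs; split=> //; exact/WU.
    have [//|Fn] := in_ultra_setVsetC [set p | g (f p).1 = v] ultraF; exfalso.
    have Fh : (h @ F) [set q | exists2 p, g (f p).1 <> v & q = h p].
      change (F (h @^-1` [set q | exists2 p, g (f p).1 <> v & q = h p])).
      by apply: filterS Fn => p np; exists p.
    have [q [[p gp ->] Wq]] := cz _ _ Fh nW.
    have : [set inl (Vertex R v) : Y] (inl (Vertex R (g (f p).1))).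
      apply: Us; split; first exact/WU.
      by move=> [_ [e [t [_ ->]]]].
    by move=> [].
  - case: Zz; exists (inl (Inner e t)) => //.
    by exists (Inner e t) => //; exists e, t.
  - by case: conv; right; exists w.
  - by case: conv; left.
have [x Fx] := ends_at (@edge_src G) (fun e => ltac:(by rewrite edgeE; left)).
have [y Fy] := ends_at edge_tgt (fun e => ltac:(by rewrite edgeE; right)).
have [p1 [p1I [/= p1x p1y]]] := filter_ex (filterI FI (filterI Fx Fy)).
pose e := (f p1).1.
have Fe : F ((i \o inl) @` [set edge_path e r | r in `[0, 1]%classic]).
  apply: filterS (filterI FI (filterI Fx Fy)) => p [pI [/= px py]].
  have ee : (f p).1 = e.
    suff E : sval (f p).1 = sval e by case: (f p).1 e E => s sP [s' s'P] /= E; exact: eq_exist.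
    by rewrite !edgeE px py p1x p1y.
  exists (Inner e (f p).2); last by rewrite /= -ee -fP.
  exists (val (f p).2); last exact: edge_path_inner.
  by case: (f p).2 => t /= /andP[tl tr]; rewrite in_itv /= !ltW.
have cE : compact ((i \o inl) @` [set edge_path e r | r in `[0, 1]%classic]).
  apply: continuous_compact; last exact: compact_edge.
  apply: continuous_subspaceT => q; apply: continuous_comp; first exact: inl_continuous.
  exact: ic.
move: cE; rewrite compact_ultra => /(_ F ultraF Fe)[z [_ Fz]].
by apply: nconv; exists z.
Qed.

End EdgeCompact.

Lemma embedding_homeomorphism (T K : topologicalType) (i : T -> K) :
  embedding i -> (forall p, range i p) -> homeomorphism i.
Proof.
move=> iE isurj; have [iI ic _] := iE; split=> //.
have /choice[g gP] : forall p, exists y, i y = p.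
  by move=> p; have [y _ yp] := isurj p; exists y.
exists g; split=> //; last by move=> y; apply: iI; rewrite gP.
apply/continuousP => U /(embedding_open iE)[W [oW WU]].
rewrite (_ : g @^-1` U = W) //; apply/seteqP; split=> p /=; last first.
  by rewrite -{1}(gP p) => /WU.
by move=> /WU; rewrite gP.
Qed.

(** * Maps between Omega-compactifications *)

Section OmegaExtensions.
Variables (R : realType) (G : graph).
Local Notation Y := (end_space R G).
Local Notation inner := (@inner_set R G).
Local Notation Y0 := (~` inner).
Implicit Types (a b : extension Y).

Lemma skeleton_or a p : skeleton a p \/ exists e t, p = ext_map a (inl (Inner e t)).
Proof.
have [[_ [_ [e [t [_ ->]]] <-] <-]|] := pselect ((ext_map a @` inner) p); last by left.
by right; exists e, t.
Qed.

Lemma inner_inr w : Y0 (inr w : Y).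
Proof. by case. Qed.

Lemma inner_vertex v : Y0 (inl (Vertex R v) : Y).
Proof. by move=> [_ [e [t [_ ->]]]]. Qed.

Lemma inner_point e t : inner (inl (Inner e t) : Y).
Proof. by exists (Inner e t) => //; exists e, t. Qed.

Lemma skeleton_ext_map a y : injective (ext_map a) -> Y0 y -> skeleton a (ext_map a y).
Proof. by move=> iI Yy [x xI /iI xy]; apply: Yy; rewrite -xy. Qed.

Lemma compact_image_skeleton a : omega_compactification a -> compact Y0 ->
  skeleton a `<=` ext_map a @` Y0.
Proof.
move=> /omega_compactificationP[ca ea cZ sZ dZ] cY z Zz.
have [iI _ _] := ea.
apply: contrapT => nz.
have [|W [oW Wz W0]] := compact_separate sZ (compact_embedding ea cY) _ Zz nz.
  by move=> _ [y Yy <-]; exact: skeleton_ext_map.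
have [y Yy Wy] := dZ W z oW Wz Zz.
have : (W `&` ext_map a @` Y0) (ext_map a y) by split=> //; exists y.
by rewrite W0.
Qed.

Theorem tough_homeomorphism a : tough G -> omega_compactification a ->
  homeomorphism (ext_map a).
Proof.
move=> tG aO; have [_ ea _ _ _] := (omega_compactificationP a).1 aO.
apply: embedding_homeomorphism => // p.
have [|[e [t ->]]] := skeleton_or p; last by exists (inl (Inner e t)).
move=> /(compact_image_skeleton aO)[|y _ <-]; last by exists y.
exact/compact_Y0.
Qed.

(** An open set whose trace is one open edge contains no point of the skeleton, since by density it
    would then contain the image of a vertex or an end. *)
Lemma inner_open a p : omega_compactification a -> (ext_map a @` inner) p ->
  exists W, [/\ open W, W p & W `<=` ext_map a @` inner].
Proof.
move=> /omega_compactificationP[_ ea _ _ dZ] [_ [_ [e [t [_ ->]]] <-] <-].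
have oU : open (inl @` [set @Inner R G e s | s in setT] : set Y).
  exact/open_inl/open_edge.
have [W [oW WU]] := embedding_open ea oU.
exists W; split=> //; first by apply/WU; exists (Inner e t) => //; exists t.
move=> q Wq; apply: contrapT => Zq.
have [y Yy /WU[_ [s _ <-] yE]] := dZ W q oW Wq Zq.
by apply: Yy; rewrite -yE; exact: inner_point.
Qed.

(** If [f z] were an inner edge point, the preimage of an open set of inner edge points would be a
    neighbourhood of [z], and by density some vertex or end would be mapped to an inner edge
    point. *)
Lemma ext_hom_skeleton a b (f : b -> a) z : omega_compactification a ->
  omega_compactification b -> ext_hom f -> skeleton b z -> skeleton a (f z).
Proof.
move=> aO bO [fc fE] Zz /(inner_open aO)[W [oW Wz WI]].
have [_ [iI _ _] _ _ _] := (omega_compactificationP a).1 aO.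
have [_ _ _ _ dZ] := (omega_compactificationP b).1 bO.
have oV : open (f @^-1` W) by move/continuousP: fc; exact.
have [y Yy Wy] := dZ _ z oV Wz Zz.
have : W (ext_map a y) by rewrite -fE.
by move=> /WI[x xI /iI xy]; apply: Yy; rewrite -xy.
Qed.

Lemma ext_hom_eq a b (f g : b -> a) z : omega_compactification a ->
  omega_compactification b -> ext_hom f -> ext_hom g -> skeleton b z -> f z = g z.
Proof.
move=> aO bO fh gh Zz; apply: contrapT => fg.
have [_ [iI _ _] _ sZ _] := (omega_compactificationP a).1 aO.
have [_ _ _ _ dZ] := (omega_compactificationP b).1 bO.
have [U [V [oU oV Uf Vg UV]]] :=
  sZ _ _ (ext_hom_skeleton aO bO fh Zz) (ext_hom_skeleton aO bO gh Zz) fg.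
have [fc fE] := fh; have [gc gE] := gh.
have oW : open (f @^-1` U `&` g @^-1` V).
  by apply: openI; [move/continuousP: fc|move/continuousP: gc]; exact.
have [y Yy [/= Uy Vy]] := dZ _ z oW (conj Uf Vg) Zz.
have : (U `&` V `&` skeleton a) (ext_map a y).
  split; last exact: skeleton_ext_map.
  by split; [move: Uy; rewrite -fE|move: Vy; rewrite -gE].
by rewrite UV.
Qed.

(** A dense locally compact subspace of a Hausdorff space is open. This is carried out within the
    skeleton; at inner edge points [inner_open] suffices. *)
Lemma open_range a : omega_compactification a -> end_tough G -> open (range (ext_map a)).
Proof.
move=> aO tE; have [_ ea cZ sZ dZ] := (omega_compactificationP a).1 aO.
have [iI _ _] := ea.
apply: openP_sub => _ [y _ <-].
have [yI|Yy] := pselect (inner y).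
  have [|W [oW Wy WI]] := @inner_open a (ext_map a y) aO; first by exists y.
  by exists W; split=> // p /WI[x _ <-]; exists x.
have [N [K [oN Ny cK KY NK]]] := end_tough_locally_compact tE Yy.
have [W [oW WN]] := embedding_open ea oN.
exists W; split=> //; first exact/WN.
move=> p Wp; have [Zp|[e [t ->]]] := skeleton_or p; last by exists (inl (Inner e t)).
apply: contrapT => np.
have nK : ~ (ext_map a @` K) p by move=> [x _ xp]; apply: np; exists x.
have [|W' [oW' Wp' W0]] := compact_separate sZ (compact_embedding ea cK) _ Zp nK.
  by move=> _ [x Kx <-]; apply: skeleton_ext_map => //; exact: KY.
have [x Yx [/WN Nx Wx']] := dZ _ p (openI oW oW') (conj Wp Wp') Zp.
have : (W' `&` ext_map a @` K) (ext_map a x).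
  by split=> //; exists x => //; exact: NK.
by rewrite W0.
Qed.

Lemma crude_setP (M : set (graph_point R G)) : crude_set M <->
  forall e t, M (Inner e t) <-> exists2 v, sval e v & M (Vertex R v).
Proof.
split=> [h e t|h].
  split=> [Me|[v ve Mv]].
    have : (M `&` inner_points R setT) (Inner e t) by split=> //; exists e, t.
    rewrite h => -[v Mv [e' [t' [ve [ee _]]]]]; subst e'.
    by exists v.
  have : (\bigcup_(v in [set v | M (Vertex R v)]) inner_points R (edges_at v)) (Inner e t).
    by exists v => //; exists e, t.
  by rewrite -h => -[].
apply/seteqP; split=> p.
  move=> [Mp [e [t [_ pE]]]]; rewrite pE in Mp *.
  by have [v ve Mv] := (h e t).1 Mp; exists v => //; exists e, t.
move=> [v Mv [e [t [ve ->]]]]; split; first by apply/h; exists v.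
by exists e, t.
Qed.

Lemma crude_set_crude_of (S : set Y) : crude_set (inl @^-1` crude_of S).
Proof. by apply/crude_setP. Qed.

(** At points of [G] the basic open sets already form a neighbourhood base, so crude sets have to be
    supplied only elsewhere. Conversely, all open sets with crude trace can serve as the family
    [B]. *)
Lemma crudeP a : continuous (ext_map a) -> crude a <->
  (forall U, @basic_open R G U -> open (ext_map a @` (inl @` U))) /\
  forall z, ~ (exists p, z = ext_map a (inl p)) -> forall W, open W -> W z ->
    exists M, [/\ open M, M z, M `<=` W & crude_set ((ext_map a \o inl) @^-1` M)].
Proof.
move=> ic; split=> [[B Bc [Bo Bb]]|[oB cB]].
  split=> [U bU|z nz W oW Wz].
    by apply: Bo; left; exists U => //; rewrite image_comp.
  have [M [BM Mz] MW] := Bb z W (open_nbhs_nbhs (conj oW Wz)).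
  case: BM => [[U _ UM]|BM]; last first.
    by exists M; split=> //; [apply: Bo; right|exact: Bc].
  by move: Mz; rewrite -UM => -[p _ pz]; case: nz; exists p.
exists [set M | open M /\ crude_set ((ext_map a \o inl) @^-1` M)]; first by move=> M [].
split=> [_ [[U bU <-]|[]//]|z A].
  by have := oB U bU; rewrite image_comp.
rewrite nbhsE => -[W [oW Wz] WA].
have [[p zE]|nz] := pselect (exists p, z = ext_map a (inl p)); last first.
  have [M [oM Mz MW Mc]] := cB z nz W oW Wz.
  by exists M; [split=> //; right|move=> q /MW/WA].
have oU : open ((ext_map a \o inl) @^-1` W : set (graph_point R G)).
  by apply: ((open_end_space (ext_map a @^-1` W)).1 _).1; move/continuousP: ic; exact.
move: zE Wz oU => ->; case: p => [v|e t] Wz oU.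
  have [i iU] := open_vertex oU Wz.
  exists ((ext_map a \o inl) @` open_star v i); last by move=> _ [q /iU Uq <-]; exact: WA.
  split; last by exists (Vertex R v) => //; left.
  by left; exists (open_star v i) => //; right; exists v, i.
have [c [d [tcd cdU]]] := open_inner oU Wz.
exists ((ext_map a \o inl) @` open_interval e c d); last by move=> _ [q /cdU Uq <-]; exact: WA.
split; last by exists (Inner e t) => //; exists t.
by left; exists (open_interval e c d) => //; left; exists e, c, d.
Qed.

End OmegaExtensions.

(** * The one-point compactification *)

Section OnePoint.
Variables (R : realType) (G : graph).
Local Notation Y := (end_space R G).
Local Notation inner := (@inner_set R G).
Local Notation Y0 := (~` inner).

Lemma open_crude_compl (K : set Y) : compact K -> K `<=` Y0 -> open (crude_of (Y0 `\` K)).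
Proof.
move=> cK KY; apply: open_crude_of => w [Yw Kw].
have [W [oW Ww W0]] := compact_separate (@separated_end_space R G) cK KY Yw Kw.
have [_ /(_ w Ww)[X finX XW]] := (open_end_space W).1 oW.
exists X => // p pX; split; first exact: hull_sub pX.
by move=> Kp; have : (W `&` K) p by [split=> //; apply: XW; exact: hull_crude_of]; rewrite W0.
Qed.

Lemma crude_of_Y0 (S : set Y) p : S `<=` Y0 -> Y0 p -> crude_of S p = S p.
Proof. by case: p => [[v|e t]|w] //= _ []; exact: inner_point. Qed.

End OnePoint.

(* The point [None] is the point at infinity. *)
Definition one_point_space (R : realType) (G : graph) : Type := option (end_space R G).

(** Compactness is asked of a set [K] of vertices and ends only. Edges are handled by crudeness: all
    inner points of an edge with an endpoint outside [K] belong to the neighbourhood of [None]. *)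
Definition one_point_open (R : realType) (G : graph) : set (set (one_point_space R G)) :=
  [set W | open (Some @^-1` W : set (end_space R G)) /\
    (W None -> exists K : set (end_space R G),
      [/\ compact K, K `<=` ~` @inner_set R G &
          crude_of (~` @inner_set R G `\` K) `<=` Some @^-1` W])].

Lemma one_point_openT (R : realType) (G : graph) : one_point_open (@setT (one_point_space R G)).
Proof.
by split=> [|_]; [rewrite preimage_setT; exact: openT|exists set0; split=> //; exact: compact0].
Qed.

Lemma one_point_openI (R : realType) (G : graph) : setI_closed (@one_point_open R G).
Proof.
move=> A B [oA hA] [oB hB]; split; first by rewrite preimage_setI; exact: openI.
move=> [/hA[K [cK KY KA]] /hB[L [cL LY LB]]]; exists (K `|` L); split.
- exact: compactU.
- by move=> p [/KY|/LY].
- move=> p pKL; split.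
    by apply: KA; apply: crude_ofS pKL => q [Yq /not_orP[]].
  by apply: LB; apply: crude_ofS pKL => q [Yq /not_orP[]].
Qed.

Lemma one_point_open_bigU (R : realType) (G : graph) (I : Type)
    (f : I -> set (one_point_space R G)) :
  (forall i, one_point_open (f i)) -> one_point_open (\bigcup_i f i).
Proof.
move=> fo; split.
  by rewrite preimage_bigcup; apply: bigcup_open => i _; case: (fo i).
move=> [i _ fi]; have [_ /(_ fi)[K [cK KY Kf]]] := fo i.
by exists K; split=> // p /Kf fp; exists i.
Qed.

HB.instance Definition _ (R : realType) (G : graph) := gen_eqMixin (one_point_space R G).
HB.instance Definition _ (R : realType) (G : graph) := gen_choiceMixin (one_point_space R G).
HB.instance Definition _ (R : realType) (G : graph) :=
  @isOpenTopological.Build (one_point_space R G) (@one_point_open R G)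
    (@one_point_openT R G) (@one_point_openI R G) (@one_point_open_bigU R G).

Definition one_point_ext (R : realType) (G : graph) : extension (end_space R G) :=
  @Extension (end_space R G) (one_point_space R G) Some.

Section OnePointCompactification.
Variables (R : realType) (G : graph).
Local Notation Y := (end_space R G).
Local Notation inner := (@inner_set R G).
Local Notation Y0 := (~` inner).
Local Notation alpha := (one_point_ext R G).
Hypotheses (ntG : ~ tough G) (etG : end_tough G).

Lemma one_point_openE (W : set (one_point_space R G)) : open W = one_point_open W.
Proof. by []. Qed.

Lemma open_Some (U : set Y) : open U -> open (Some @` U : set (one_point_space R G)).
Proof.
move=> oU; rewrite one_point_openE; split; last by move=> [].
rewrite (_ : _ @^-1` _ = U) //; apply/seteqP; split=> [p [q Uq [<-]]//|p Up].
by exists p.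
Qed.

Lemma open_None (K : set Y) : compact K -> K `<=` Y0 ->
  open ([set None] `|` Some @` crude_of (Y0 `\` K) : set (one_point_space R G)).
Proof.
move=> cK KY; rewrite one_point_openE.
have E : Some @^-1` ([set None] `|` Some @` crude_of (Y0 `\` K)) = crude_of (Y0 `\` K).
  by apply/seteqP; split=> [p [//|[q Uq [<-]]//]|p Up]; right; exists p.
split; rewrite E; first exact: open_crude_compl.
by move=> _; exists K; split.
Qed.

Lemma one_point_embedding : embedding (Some : Y -> one_point_space R G).
Proof.
split.
- by move=> x y [].
- by apply/continuousP => W; rewrite one_point_openE => -[].
- move=> U oU; exists (Some @` U); first exact: open_Some.
  by apply/seteqP; split=> [_ [x Ux <-]|_ [[x Ux <-] _]]; [split; exists x|exists x].
Qed.

Lemma skeleton_Some y : skeleton alpha (Some y) <-> Y0 y.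
Proof.
split=> [h yI|Yy [x xI [xy]]]; first by apply: h; exists y.
by apply: Yy; rewrite -xy.
Qed.

Lemma skeleton_None : skeleton alpha None.
Proof. by move=> []. Qed.

Lemma compact_one_point_skeleton : compact (skeleton alpha).
Proof.
rewrite compact_ultra => F ultraF FZ; have FF : ProperFilter F := ultra_proper.
have [FN|/existsNP[W /not_implyP[]]] := pselect (F --> (None : alpha)).
  by exists None; split=> //; exact: skeleton_None.
rewrite /= nbhsE => -[U [oU UN] UW] FW.
have [_ /(_ UN)[K [cK KY KU]]] := oU.
have FK : F (Some @` K : set alpha).
  have [/FW//|FnW] := in_ultra_setVsetC W ultraF.
  apply: filterS (filterI FZ FnW) => -[y|] [Zy Wy]; last by case: Wy; exact: UW.
  have Yy := (skeleton_Some y).1 Zy.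
  exists y => //; apply: contrapT => Ky; apply/Wy/UW/KU.
  by rewrite (crude_of_Y0 (@subDsetl _ _ _) Yy).
have := compact_embedding one_point_embedding cK; rewrite compact_ultra.
move=> /(_ F ultraF FK)[z [[y Ky <-] Fy]]; exists (Some y); split=> //.
exact/skeleton_Some/KY.
Qed.

Lemma separated_one_point_skeleton : separated_in (skeleton alpha).
Proof.
have None_Some y : Y0 y -> exists U V : set alpha,
    [/\ open U, open V, U None, V (Some y) & U `&` V `&` skeleton alpha = set0].
  move=> Yy; have [N [K [oN Ny cK KY NK]]] := end_tough_locally_compact etG Yy.
  exists ([set None] `|` Some @` crude_of (Y0 `\` K)), (Some @` N); split.
  - exact: open_None.
  - exact: open_Some.
  - by left.
  - by exists y.
  - apply/seteqP; split=> // z [[Uz [x Nx xz]] Zz]; subst z.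
    have Yx := (skeleton_Some x).1 Zz.
    case: Uz => [//|[x' + [xx]]]; subst x'.
    by rewrite (crude_of_Y0 (@subDsetl _ _ _) Yx) => -[_ nK]; apply/nK/NK.
move=> [x|] [y|] Zx Zy xy //.
- have Yx := (skeleton_Some x).1 Zx; have Yy := (skeleton_Some y).1 Zy.
  have [|U [V [oU oV Ux Vy UV]]] := separated_end_space Yx Yy.
    by move=> E; apply: xy; rewrite E.
  exists (Some @` U), (Some @` V).
  split; [exact: open_Some|exact: open_Some|by exists x|by exists y|].
  apply/seteqP; split=> // z [[[p Up <-] [q Vq [qp]]] Zz]; subst q.
  by have : (U `&` V `&` Y0) p by [split=> //; exact/skeleton_Some]; rewrite UV.
- have [U [V [oU oV Ux Vy UV]]] := None_Some x ((skeleton_Some x).1 Zx).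
  by exists V, U; rewrite (setIC V).
- exact/None_Some/skeleton_Some.
Qed.

(** End-toughness provides the compact neighbourhoods that separate [None] from vertices and ends.
    Non-toughness puts [None] in the closure of the rest: otherwise the vertices and ends would
    already form a compact set. *)
Lemma one_point_omega : omega_compactification alpha.
Proof.
apply/omega_compactificationP; split.
- apply: (compact_of_skeleton one_point_embedding).
    exact: compact_one_point_skeleton.
  move=> z zI W; rewrite {1}nbhsE => -[U [oU Uz] UW].
  case: z zI Uz => [y [nr|[w [yw]]]|_] Uz.
  + by case: nr; exists y.
  + subst y; have [/open_end_space[_ /(_ w Uz)[X finX XU]] _] := oU.
    have cX := closed_off_component (end_comp_component w finX).
    exists (Some @` crude_of (hull R (end_comp X w))).
      apply: open_nbhs_nbhs; split; first exact/open_Some/(open_hull R finX cX).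
      by exists (inr w) => //; exact: tails_in_end_comp.
    split; first by move=> _ [q /XU /UW Wq <-].
    move=> v e t ve [q qX [qv]]; subst q.
    by exists (inl (Inner e t)) => //; exists v.
  + have [_ /(_ Uz)[K [cK KY KU]]] := oU.
    exists ([set None] `|` Some @` crude_of (Y0 `\` K)).
      by apply: open_nbhs_nbhs; split; [exact: open_None|left].
    split; first by move=> _ [->|[y /KU Uy <-]]; exact: UW.
    move=> v e t ve [//|[q qK [qv]]]; subst q.
    by right; exists (inl (Inner e t)) => //; exists v.
- exact: one_point_embedding.
- exact: compact_one_point_skeleton.
- exact: separated_one_point_skeleton.
- move=> W [y|] oW Wz Zz; first by exists y => //; exact/skeleton_Some.
  have [_ /(_ Wz)[K [cK KY KW]]] := oW.
  have [y Yy Ky] : exists2 y, Y0 y & ~ K y.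
    apply: contrapT => h; apply: ntG; apply/(compact_Y0 R).
    rewrite (_ : Y0 = K) //; apply/seteqP; split=> // y Yy.
    by apply: contrapT => Ky; apply: h; exists y.
  exists y => //; apply: KW; by rewrite (crude_of_Y0 (@subDsetl _ _ _) Yy).
Qed.

Lemma one_point_crude : crude alpha.
Proof.
apply/crudeP; first by case: one_point_embedding.
split=> [U /basic_open_open/open_inl/open_Some //|z nz W oW Wz].
case: z nz Wz => [[p|w]|] nz Wz.
- by case: nz; exists p.
- have [/open_end_space[_ /(_ w Wz)[X finX XW]] _] := oW.
  have cX := closed_off_component (end_comp_component w finX).
  exists (Some @` crude_of (hull R (end_comp X w))); split.
  + exact/open_Some/(open_hull R finX cX).
  + by exists (inr w) => //; exact: tails_in_end_comp.
  + by move=> _ [y /XW Wy <-].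
  + rewrite (_ : _ @^-1` _ = inl @^-1` crude_of (hull R (end_comp X w))).
      exact: crude_set_crude_of.
    by apply/seteqP; split=> p; [move=> [q qX /= [qp]]; subst q|exists (inl p)].
- have [_ /(_ Wz)[K [cK KY KW]]] := oW.
  exists ([set None] `|` Some @` crude_of (Y0 `\` K)); split.
  + exact: open_None.
  + by left.
  + by move=> _ [->//|[y /KW Wy <-]].
  + rewrite (_ : _ @^-1` _ = inl @^-1` crude_of (Y0 `\` K)).
      exact: crude_set_crude_of.
    by apply/seteqP; split=> p; [move=> [//|[q qX /= [qp]]]; subst q|right; exists (inl p)].
Qed.

Lemma one_point_remainder : remainder alpha = [set None].
Proof.
apply/seteqP; split=> [[y|] //|_ -> []//]; first by case; exists y.
Qed.

End OnePointCompactification.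

(** * Quotients by the fibres of a map *)

Section FibreQuotientTheory.
Variables (K L : topologicalType) (f : K -> L).
Local Notation pi := (fibre_pi f).

Lemma fibre_pi_surj (q : fibre_quotient f) : exists x, pi x = q.
Proof. by exists (repr q); rewrite /fibre_pi reprK. Qed.

Lemma fibre_piP x y : pi x = pi y <-> f x = f y.
Proof.
split=> [h|fxy].
  by have /eqmodP/eqP : (x = y %[mod {eq_quot same_fibre_equiv f}])%qT := h.
have : (x = y %[mod {eq_quot same_fibre_equiv f}])%qT by apply/eqmodP/eqP.
exact.
Qed.

Lemma fibre_pi_open (W : set (fibre_quotient f)) : open W <-> open (pi @^-1` W).
Proof. by []. Qed.

Lemma fibre_pi_continuous : continuous pi.
Proof. by apply/continuousP => W /fibre_pi_open. Qed.

Lemma fibre_pi_image (S : set K) : (forall x y, f x = f y -> S x -> S y) ->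
  pi @^-1` (pi @` S) = S.
Proof.
move=> sat; apply/seteqP; split=> [x [y Sy /fibre_piP yx]|x Sx]; last by exists x.
exact: sat yx Sy.
Qed.

Lemma quotient_map_homeomorphism : continuous f -> (forall z, range f z) ->
  (forall U, open (f @^-1` U) -> open U) ->
  exists2 g : L -> fibre_quotient f, (forall x, g (f x) = pi x) & homeomorphism g.
Proof.
move=> fc fsurj fq.
have /choice[s sP] : forall z, exists x, f x = z.
  by move=> z; have [x _ xz] := fsurj z; exists x.
have gE x : pi (s (f x)) = pi x by apply/fibre_piP; rewrite sP.
exists (pi \o s) => //; split.
  apply/continuousP => W oW; apply: fq.
  rewrite (_ : _ @^-1` _ = pi @^-1` W) //.
  by apply/seteqP; split=> x /=; rewrite gE.
exists (f \o repr); split.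
- apply: repr_comp_continuous => // x y /eqP /fibre_piP ->; exact: eqxx.
- move=> z /=; have : pi (repr (pi (s z))) = pi (s z) by rewrite /fibre_pi reprK.
  by move/fibre_piP; rewrite sP.
- by move=> q /=; rewrite gE /fibre_pi reprK.
Qed.

End FibreQuotientTheory.

(** * Collapsing the remainder of a crude compactification *)

Section Collapse.
Variables (R : realType) (G : graph).
Local Notation Y := (end_space R G).
Local Notation inner := (@inner_set R G).
Local Notation Y0 := (~` inner).
Local Notation alpha := (one_point_ext R G).
Hypotheses (ntG : ~ tough G) (etG : end_tough G).
Implicit Types d : extension Y.

Definition collapse d (z : d) : alpha :=
  match pselect (exists y, ext_map d y = z) with
  | left h => Some (sval (cid h))
  | right _ => None
  end.

Lemma collapse_ext_map d y : injective (ext_map d) -> collapse (ext_map d y) = Some y.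
Proof.
move=> iI; rewrite /collapse; case: pselect => [h|[]]; last by exists y.
by congr Some; apply: iI; exact: (svalP (cid h)).
Qed.

Lemma collapse_remainder d (z : d) : ~ range (ext_map d) z -> collapse z = None.
Proof.
move=> nz; rewrite /collapse; case: pselect => // h; exfalso.
by have [y yz] := h; apply: nz; exists y.
Qed.

Lemma remainder_skeleton d (z : d) : ~ range (ext_map d) z -> skeleton d z.
Proof. by move=> nz [y _ yz]; apply: nz; exists y. Qed.

(** On the image of the end space, which is open, there is nothing to collapse. A remainder point
    has an open neighbourhood disjoint from the compact image of [K], and inside it a crude one; an
    inner edge point of the latter has an endpoint there too, and this endpoint is not in [K]. So
    the edge is mapped into the given neighbourhood of [None]. *)
Lemma collapse_ext_hom d : crude_omega d -> ext_hom (@collapse d).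
Proof.
move=> [dO dc]; have [cd ed cZ sZ dZ] := (omega_compactificationP d).1 dO.
have [iI ic _] := ed.
have [_ crd] := (crudeP ic).1 dc.
split; last by apply/funext => y; exact: collapse_ext_map.
apply/continuousP => W oW; apply: openP_sub => z Wz.
have [[y _ yz]|nz] := pselect (range (ext_map d) z).
  subst z; have [oWY _] := oW.
  have [U [oU UW]] := embedding_open ed oWY.
  exists (U `&` range (ext_map d)); split.
  - exact: openI (open_range dO etG).
  - split; last by exists y.
    by apply/UW; move: Wz; rewrite /preimage /= collapse_ext_map.
  - move=> p [Up [x _ xp]]; subst p; rewrite /preimage /= collapse_ext_map //; exact/UW.
have Zz := remainder_skeleton nz.
move: Wz; rewrite {1}/preimage /= collapse_remainder // => WN.
have [_ /(_ WN)[K [cK KY KW]]] := oW.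
have nK : ~ (ext_map d @` K) z by move=> [x _ xz]; apply: nz; exists x.
have [|U [oU Uz U0]] := compact_separate sZ (compact_embedding ed cK) _ Zz nK.
  by move=> _ [x Kx <-]; apply: skeleton_ext_map => //; exact: KY.
have [|M [oM Mz MU Mc]] := crd z _ U oU Uz; first by move=> [p pz]; apply: nz; exists (inl p).
have KM x : K x -> ~ M (ext_map d x).
  move=> Kx /MU Ux.
  by have : (U `&` ext_map d @` K) (ext_map d x) by [split=> //; exists x]; rewrite U0.
exists M; split=> // p Mp; rewrite /preimage /=.
have [[y _ yp]|np] := pselect (range (ext_map d) p); last by rewrite collapse_remainder.
subst p; rewrite collapse_ext_map //; apply: KW.
have KY' y' : Y0 y' -> M (ext_map d y') -> (Y0 `\` K) y' by move=> Yy' My'; split=> // /KM.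
case: y Mp => [[v|e t]|w] Mp.
- by apply: KY' Mp; exact: inner_vertex.
- have [v ve Mv] := ((crude_setP _).1 Mc e t).1 Mp.
  by exists v => //; apply: KY' Mv; exact: inner_vertex.
- by apply: KY' Mp; exact: inner_inr.
Qed.

Lemma collapse_unique d (f : d -> alpha) : crude_omega d -> ext_hom f -> f = @collapse d.
Proof.
move=> dc fh; have [dO _] := dc.
have [_ [iI _ _] _ _ _] := (omega_compactificationP d).1 dO.
apply/funext => z; have [Zz|[e [t ->]]] := skeleton_or z.
  exact: ext_hom_eq (one_point_omega R ntG etG) dO fh (collapse_ext_hom dc) Zz.
by rewrite collapse_ext_map //; have [_ fE] := fh; rewrite -[RHS]/(ext_map alpha _) -fE.
Qed.

Lemma remainder_ex d : omega_compactification d -> exists z, ~ range (ext_map d) z.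
Proof.
move=> dO; have [_ ed cZ _ _] := (omega_compactificationP d).1 dO.
apply: contrapT => /forallNP h; apply: ntG; apply/(compact_Y0 R).
apply: (embedding_compact ed).
rewrite (_ : _ @` _ = skeleton d) //; apply/seteqP; split.
  by move=> _ [y Yy <-]; apply: skeleton_ext_map => //; case: ed.
move=> z Zz; have [y _ yz] := contrapT (h z).
by exists y => // yI; apply: Zz; exists y.
Qed.

Lemma one_point_coarsest : coarsest (@crude_omega R G) alpha.
Proof.
split; first by split; [exact: one_point_omega|exact: one_point_crude].
by move=> d dc; exists (@collapse d); exact: collapse_ext_hom.
Qed.

(* An open [M] containing the remainder of [d] leaves a compact rest of the
   skeleton, so its image is a neighbourhood of the point at infinity. *)
Lemma collapse_quotient_map d (U : set alpha) : crude_omega d ->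
  open (@collapse d @^-1` U) -> open U.
Proof.
move=> dc oU; have [dO dcr] := dc.
have [cd ed cZ sZ dZ] := (omega_compactificationP d).1 dO; have [iI ic _] := ed.
have [_ crd] := (crudeP ic).1 dcr.
have EU : Some @^-1` U = ext_map d @^-1` (@collapse d @^-1` U).
  by apply/seteqP; split=> y; rewrite /preimage /= collapse_ext_map.
change (one_point_open U); split.
  by rewrite EU; move/continuousP: ic; exact.
move=> UN.
(* All crude open subsets of the preimage of [U] are united; as [d] is crude, they cover the
   remainder. *)
pose M := \bigcup_(M in [set M : set d | [/\ open M, M `<=` @collapse d @^-1` U &
  crude_set ((ext_map d \o inl) @^-1` M)]]) M.
have oM : open M by apply: bigcup_open => N [].
have MU : M `<=` @collapse d @^-1` U by move=> z [N [_ NU _] /NU].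
have Mrem z : ~ range (ext_map d) z -> M z.
  move=> nz; have [||N [oN Nz NU Nc]] := crd z _ _ oU.
  - by move=> [p pz]; apply: nz; exists (inl p).
  - by rewrite /preimage /= collapse_remainder.
  - by exists N.
exists (Y0 `&` ext_map d @^-1` (~` M)); split; last 1 first.
- move=> [[v|e t]|w] /=.
  + move=> [Yv /not_andP[//|/contrapT /MU]].
    by rewrite /preimage /= collapse_ext_map.
  + move=> [v ve [Yv /not_andP[//|/contrapT [N NP Nv]]]].
    have [_ NU Nc] := NP.
    have : N (ext_map d (inl (Inner e t))).
      by apply/((crude_setP _).1 Nc e t); exists v.
    by move=> /NU; rewrite /preimage /= collapse_ext_map.
  + move=> [Yv /not_andP[//|/contrapT /MU]].
    by rewrite /preimage /= collapse_ext_map.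
- apply: (embedding_compact ed).
  rewrite (_ : _ @` _ = skeleton d `\` M); first exact: closed_compactD.
  apply/seteqP; split=> [_ [y [Yy My] <-]|z [Zz Mz]].
    by split=> //; exact: skeleton_ext_map.
  have [y _ yz] : range (ext_map d) z by apply: contrapT => /Mrem.
  subst z; exists y => //; split=> //.
  by move=> yI; apply: Zz; exists y.
- by move=> y [].
Qed.

Lemma one_point_quotient d (f : d -> alpha) : crude_omega d -> ext_hom f ->
  top_equivalent (quotient_ext f) alpha.
Proof.
move=> dc fh; have fE := collapse_unique dc fh; have [fc fi] := fh.
have [||g gE gh] := quotient_map_homeomorphism fc.
- move=> [y|]; first by exists (ext_map d y) => //; rewrite -[RHS]/(ext_map alpha y) -fi.
  have [z nz] := remainder_ex dc.1; exists z => //.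
  by rewrite fE collapse_remainder.
- by move=> U; rewrite fE; exact: collapse_quotient_map.
- exists g => //; split; first by case: gh.
  by apply/funext => y /=; rewrite -gE -[Some y]/(ext_map alpha y) -fi.
Qed.

Lemma tangle_remainder (t : tangles G) : (forall w, end_tangle w <> t) ->
  remainder (tangle_ext R G) (inr t).
Proof. by move=> nt [[p|w] _ [//]] => /nt. Qed.

(** An equivalence is injective and already uses up every [Some y] on the image of the end space, so
    all tangles that are no ends would go to [None]; there are at least two of them. *)
Lemma one_point_not_tangle : ~ top_equivalent alpha (tangle_ext R G).
Proof.
move=> [f [fc fE] [_ [g [_ fK _]]]].
have [t1 [t2 [t12 tn]]] := two_ultra_tangles ntG.
have fN t : (forall w, end_tangle w <> t) -> f (inr t : tangle_ext R G) = None.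
  move=> nt; case E : (f _) => [y|] //; case: (tangle_remainder nt).
  exists y => //; rewrite -[RHS]fK E -[Some y]/(ext_map alpha y) -fE.
  by rewrite -[LHS]fK.
have : (inr t1 : tangle_ext R G) = inr t2.
  by rewrite -[LHS]fK -[RHS]fK !fN // => w; case: (tn w).
by move=> [].
Qed.

End Collapse.

(** * Remainders with at least two points *)

Section LargeRemainder.
Variables (R : realType) (G : graph).
Local Notation Y := (end_space R G).
Local Notation inner := (@inner_set R G).
Local Notation Y0 := (~` inner).
Implicit Types a b : extension Y.

Lemma open_hull_compl X C : finite_set X -> components X C ->
  open (crude_of (Y0 `\` hull R C)).
Proof.
move=> finX cC; apply: open_crude_of => w [_ nC]; exists X => // p hp.
split; first exact: hull_sub hp.
move=> hC; apply: nC; have [x [Ex Cx]] := hullI hp hC.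
by rewrite -(components_eq (end_comp_component w finX) cC Ex Cx); exact: tails_in_end_comp.
Qed.

(** For suitable [X] the hull of the component of [w] is mapped into [U], away from [W] and so from
    the remainder. Its image is then the skeleton minus an open set, namely [W] together with an
    open set covering the other vertices and ends; so it is compact, which forces the component to
    be tough. *)
Lemma compact_end_neighbourhood a w (U W : set a) : omega_compactification a ->
  open U -> open W -> U (ext_map a (inr w)) -> remainder a `<=` W ->
  U `&` W `&` skeleton a = set0 -> tough_end w.
Proof.
move=> aO oU oW Uw remW UW0.
have [ca ea cZ sZ dZ] := (omega_compactificationP a).1 aO; have [iI ic _] := ea.
have oV : open (ext_map a @^-1` U) by move/continuousP: ic; exact.
have [_ /(_ w Uw)[X finX XU]] := (open_end_space _).1 oV.
have cE := end_comp_component w finX.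
exists X => //; apply/tough_induced.
apply: (tough_in_compact (R := R) finX (closed_off_component cE)).
apply: (embedding_compact ea).
have [W' [oW' WS]] := embedding_open ea (open_hull_compl finX cE).
rewrite (_ : _ @` _ = skeleton a `\` (W `|` W')).
  by apply: closed_compactD => //; exact: openU.
apply/seteqP; split=> [_ [y hy <-]|z [Zz /not_orP[nW nW']]].
  have Yy := hull_sub hy; have Zy := skeleton_ext_map iI Yy.
  split=> // -[Wy|/WS].
    have : (U `&` W `&` skeleton a) (ext_map a y).
      by do 2 split => //; apply: XU; exact: hull_crude_of.
    by rewrite UW0.
  by rewrite (crude_of_Y0 (@subDsetl _ _ _) Yy) => -[].
have [y _ yz] : range (ext_map a) z by apply: contrapT => /remW.
subst z; exists y => //.
have Yy : Y0 y by move=> yI; apply: Zz; exists y.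
apply: contrapT => nh; apply: nW'; apply/WS.
by rewrite (crude_of_Y0 (@subDsetl _ _ _) Yy).
Qed.

Lemma small_remainder_end_tough a : omega_compactification a ->
  (forall x y : a, remainder a x -> remainder a y -> x = y) -> end_tough G.
Proof.
move=> aO rem1 w; have [ca ea cZ sZ dZ] := (omega_compactificationP a).1 aO.
have [iI _ _] := ea.
have [[z nz]|nr] := pselect (exists z, remainder a z); last first.
  apply: (@compact_end_neighbourhood a w setT set0) => //.
  - exact: openT.
  - exact: open0.
  - by move=> z nz; case: nr; exists z.
  - by rewrite setI0 set0I.
have Zw := skeleton_ext_map iI (@inner_inr R G w).
have [|U [V [oU oV Uw Vz UV]]] := sZ _ z Zw (remainder_skeleton nz).
  by move=> wz; apply: nz; exists (inr w).
apply: (@compact_end_neighbourhood a w U V) => //.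
by move=> x nx; rewrite (rem1 x z).
Qed.

(** * Identifying two points of the remainder *)

Section Merge.
Variables (a : extension Y) (x1 x2 : a).
Hypotheses (aO : omega_compactification a) (x12 : x1 <> x2).
Hypotheses (rem1 : remainder a x1) (rem2 : remainder a x2).

(** Only the fibres of this map matter: it presents the identification of [x1] with [x2] as a
    [fibre_quotient], and its continuity is never claimed. *)
Definition merge_points (x : a) : a := if pselect (x = x2) then x1 else x.

Local Notation pi := (fibre_pi merge_points).
Definition merged : extension Y := quotient_ext merge_points.

Let apart : set a := [set x | x <> x1 /\ x <> x2].

Lemma merge_pointsE x y : merge_points x = merge_points y ->
  x = y \/ ~ apart x /\ ~ apart y.
Proof.
rewrite /merge_points /apart /=.
case: pselect => xn; case: pselect => yn /= xy.
- by left; rewrite xn yn.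
- by right; rewrite -xy; split=> -[].
- by right; rewrite xy; split=> -[].
- by left.
Qed.

(** The two points are closed: within the skeleton by separation, and against inner edge points
    because these have neighbourhoods that miss the skeleton. *)
Lemma open_apart : open apart.
Proof.
have [ca ea cZ sZ dZ] := (omega_compactificationP a).1 aO.
have sep x z : remainder a z -> x <> z -> exists W, [/\ open W, W x & ~ W z].
  move=> nz xz; have Zz := remainder_skeleton nz.
  have [Zx|[e [t xE]]] := skeleton_or x.
    have [U [V [oU oV Ux Vz UV]]] := sZ x z Zx Zz xz.
    exists U; split=> // Uz; have : (U `&` V `&` skeleton a) z by [].
    by rewrite UV.
  have [|W [oW Wx WI]] := @inner_open _ _ a x aO.
    by rewrite xE; exists (inl (Inner e t)) => //; exact: inner_point.
  by exists W; split=> // /WI.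
apply: openP_sub => x [n1 n2].
have [W1 [oW1 W1x nW1]] := sep x x1 rem1 n1; have [W2 [oW2 W2x nW2]] := sep x x2 rem2 n2.
exists (W1 `&` W2); split=> //; first exact: openI.
by move=> y [Wy1 Wy2]; split=> yE; subst y.
Qed.

Lemma not_apart x : ~ apart x -> x = x1 \/ x = x2.
Proof. by move=> nx; apply: contrapT => /not_orP. Qed.

Lemma apart_range y : apart (ext_map a y).
Proof. by split=> yE; [apply: rem1|apply: rem2]; exists y. Qed.

Lemma merge_pi_range x y : pi x = pi (ext_map a y) -> x = ext_map a y.
Proof. by move=> /fibre_piP/merge_pointsE[//|[_ []]]; exact: apart_range. Qed.

Lemma merge_pi_image (S : set a) : (S x1 <-> S x2) -> pi @^-1` (pi @` S) = S.
Proof.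
move=> S12; apply: fibre_pi_image => x y /merge_pointsE[->//|[nx ny]].
have hx := not_apart nx.
have hy := not_apart ny.
by case: hx hy => -> [] -> //; rewrite S12.
Qed.

Lemma merge_pi_open (S : set a) : (S x1 <-> S x2) -> open S -> open (pi @` S).
Proof. by move=> S12 oS; apply/fibre_pi_open; rewrite merge_pi_image. Qed.

Lemma merge_apart (S : set a) : S `<=` apart -> (S x1 <-> S x2).
Proof. by move=> Sa; split=> /Sa[]. Qed.

Lemma merged_embedding : embedding (ext_map merged).
Proof.
have [_ ea _ _ _] := (omega_compactificationP a).1 aO; have [iI ic _] := ea.
split.
- by move=> x y /merge_pi_range/iI.
- by move=> x; apply: continuous_comp; [exact: ic|exact: fibre_pi_continuous].
- move=> U oU; have [W [oW WU]] := embedding_open ea oU.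
  have sat : (W `&` apart) x1 <-> (W `&` apart) x2 by apply: merge_apart => x [].
  exists (pi @` (W `&` apart)); first by apply: merge_pi_open => //; exact: openI open_apart.
  apply/seteqP; split=> [_ [x Ux <-]|z [[x [Wx _] xz] [y _ yz]]].
    split; last by exists x.
    by exists (ext_map a x) => //; split; [exact/WU|exact: apart_range].
  have xy : x = ext_map a y by apply: merge_pi_range; rewrite xz -yz.
  by exists y => //; apply/WU; rewrite -xy.
Qed.

Lemma skeleton_merged x : skeleton merged (pi x) <-> skeleton a x.
Proof.
split=> h [y yI yx]; apply: h; exists y => //; first by rewrite /= yx.
exact/esym/merge_pi_range.
Qed.

Lemma merged_omega : omega_compactification merged.
Proof.
have [ca ea cZ sZ dZ] := (omega_compactificationP a).1 aO; have [iI ic _] := ea.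
have pic : continuous pi := @fibre_pi_continuous _ _ _.
apply/omega_compactificationP; split.
- rewrite (_ : setT = pi @` setT).
    by apply: continuous_compact => //; exact: continuous_subspaceT.
  by apply/seteqP; split=> // q _; have [x <-] := fibre_pi_surj q; exists x.
- exact: merged_embedding.
- rewrite (_ : skeleton merged = pi @` skeleton a).
    by apply: continuous_compact => //; exact: continuous_subspaceT.
  apply/seteqP; split=> [q|_ [x Zx <-]]; last exact/skeleton_merged.
  by have [x <-] := fibre_pi_surj q => /skeleton_merged Zx; exists x.
- have sepI (U V : set a) x y : (U x1 <-> U x2) -> (V x1 <-> V x2) -> open U -> open V ->
      U x -> V y -> U `&` V `&` skeleton a = set0 ->
      exists U V, [/\ open U, open V, U (pi x), V (pi y) & U `&` V `&` skeleton merged = set0].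
    move=> U12 V12 oU oV Ux Vy UV; exists (pi @` U), (pi @` V); split.
    + exact: merge_pi_open.
    + exact: merge_pi_open.
    + by exists x.
    + by exists y.
    + apply/seteqP; split=> // q [[[p Up <-] pV] /skeleton_merged Zp].
      have Vp : V p by rewrite -(merge_pi_image V12).
      by have : (U `&` V `&` skeleton a) p by []; rewrite UV.
  have Z1 := remainder_skeleton rem1; have Z2 := remainder_skeleton rem2.
  (* To separate [x] from the merged point, it is separated from [x1] and from [x2]; the union of
     the two neighbourhoods on their side is saturated. *)
  have sep1 x : skeleton a x -> apart x -> exists U V, [/\ open U, open V, U x, U `<=` apart &
      [/\ V x1, V x2 & U `&` V `&` skeleton a = set0]].
    move=> Zx [n1 n2]; have [U [V [oU oV Ux Vx1 UV]]] := sZ x x1 Zx Z1 n1.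
    have [U' [V' [oU' oV' Ux' Vx2 UV']]] := sZ x x2 Zx Z2 n2.
    exists (U `&` U' `&` apart), (V `|` V'); split.
    + by apply: openI; [exact: openI|exact: open_apart].
    + exact: openU.
    + by [].
    + by move=> p [].
    + split; [by left|by right|apply/seteqP; split=> // p [[[[Up Up'] _] [Vp|Vp]] Zp]].
        by have : (U `&` V `&` skeleton a) p by []; rewrite UV.
      by have : (U' `&` V' `&` skeleton a) p by []; rewrite UV'.
  move=> q q'; have [x <-] := fibre_pi_surj q; have [y <-] := fibre_pi_surj q'.
  move=> /skeleton_merged Zx /skeleton_merged Zy xy.
  have [ax|nx] := pselect (apart x); have [ay|ny] := pselect (apart y).
  + have [|U [V [oU oV Ux Vy UV]]] := sZ x y Zx Zy; first by move=> E; apply: xy; rewrite E.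
    have oUa := openI oU open_apart; have oVa := openI oV open_apart.
    have sU : (U `&` apart) x1 <-> (U `&` apart) x2 by apply: merge_apart => p [].
    have sV : (V `&` apart) x1 <-> (V `&` apart) x2 by apply: merge_apart => p [].
    apply: (sepI _ _ x y sU sV oUa oVa (conj Ux ax) (conj Vy ay)).
    apply/seteqP; split=> // p [[[Up _] [Vp _]] Zp].
    by have : (U `&` V `&` skeleton a) p by []; rewrite UV.
  + have [U [V [oU oV Ux Ua [V1 V2 UV]]]] := sep1 x Zx ax.
    apply: (sepI U V) => //; first exact: merge_apart.
    have hy := not_apart ny.
    by case: hy => ->.
  + have [U [V [oU oV Uy Ua [V1 V2 UV]]]] := sep1 y Zy ay.
    apply: (sepI V U) => //; first exact: merge_apart.
      have hx := not_apart nx.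
      by case: hx => ->.
    by rewrite (setIC V).
  + case: xy; apply/fibre_piP; rewrite /merge_points.
    have hx := not_apart nx.
    have hy := not_apart ny.
    by case: hx => ->; case: hy => ->; case: pselect => //; case: pselect.
- move=> W q oW Wq; have [x xq] := fibre_pi_surj q; subst q => /skeleton_merged Zx.
  have oW' : open (pi @^-1` W) by exact/fibre_pi_open.
  exact: dZ oW' Wq Zx.
Qed.

Lemma merged_crude : crude a -> crude merged.
Proof.
have [ca ea cZ sZ dZ] := (omega_compactificationP a).1 aO; have [iI ic _] := ea.
have [_ ic' _] := merged_embedding.
move=> /(crudeP ic)[ob cr]; apply/(crudeP ic'); split=> [U bU|q nq W oW Wq].
  rewrite (_ : _ @` _ = pi @` (ext_map a @` (inl @` U))); last by rewrite !image_comp.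
  apply: merge_pi_open; last exact: ob.
  by apply: merge_apart => _ [y _ <-]; exact: apart_range.
have [x xq] := fibre_pi_surj q; subst q.
have oW' : open (pi @^-1` W) by exact/fibre_pi_open.
have nG z : remainder a z -> ~ exists p, z = ext_map a (inl p).
  by move=> nz [p zE]; apply: nz; exists (inl p).
(* The crude set has to be saturated: away from the merged point it is chosen inside [apart], and at
   the merged point crude sets around [x1] and [x2] are united. *)
have [M [oM Mx MW [M12 Mc]]] : exists M, [/\ open M, M x, M `<=` pi @^-1` W &
    (M x1 <-> M x2) /\ crude_set ((ext_map a \o inl) @^-1` M)].
  have [ax|nx] := pselect (apart x).
    have nGx : ~ exists p, x = ext_map a (inl p).
      by move=> [p xE]; apply: nq; exists p; rewrite xE.
    have [M [oM Mx MW Mc]] := cr x nGx _ (openI oW' open_apart) (conj Wq ax).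
    exists M; split=> //; first by move=> p /MW[].
    by split=> //; apply: merge_apart => p /MW[].
  have hx := not_apart nx.
  have pi12 : pi x1 = pi x2.
    by apply/fibre_piP; rewrite /merge_points; case: pselect => //; case: pselect.
  have W1 : (pi @^-1` W) x1 by move: Wq; case: hx => ->; rewrite /preimage /= ?pi12.
  have W2 : (pi @^-1` W) x2 by rewrite /preimage /= -pi12.
  have [M1 [oM1 M1x MW1 Mc1]] := cr x1 (nG x1 rem1) _ oW' W1.
  have [M2 [oM2 M2x MW2 Mc2]] := cr x2 (nG x2 rem2) _ oW' W2.
  exists (M1 `|` M2); split.
  + exact: openU.
  + by case: hx => ->; [left|right].
  + by move=> p [/MW1|/MW2].
  + split; first by split=> _; [right|left].
    apply/crude_setP => e t; split.
      by move=> [/((crude_setP _).1 Mc1 e t)|/((crude_setP _).1 Mc2 e t)] [v ve Mv];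
        exists v => //; [left|right].
    move=> [v ve [Mv|Mv]].
      by left; apply/((crude_setP _).1 Mc1 e t); exists v.
    by right; apply/((crude_setP _).1 Mc2 e t); exists v.
exists (pi @` M); split.
- exact: merge_pi_open.
- by exists x.
- by move=> _ [p /MW Wp <-].
- rewrite (_ : _ @^-1` _ = (ext_map a \o inl) @^-1` M) //.
  by rewrite -[in RHS](merge_pi_image M12).
Qed.

(** A map from [merged] back to [a], preceded by the projection, fixes the image of the end space
    and hence the whole skeleton; but it takes the same value at [x1] and [x2]. *)
Lemma merged_not_coarser : ~ coarser a merged.
Proof.
move=> [f [fc fE]]; apply: x12.
have gh : @ext_hom _ a a (f \o pi).
  split; first by move=> x; apply: continuous_comp; [exact: fibre_pi_continuous|exact: fc].
  by apply/funext => y; rewrite -[RHS](congr1 (fun h => h y) fE).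
have idh : @ext_hom _ a a id by split=> // x.
have Z1 := remainder_skeleton rem1; have Z2 := remainder_skeleton rem2.
rewrite -[LHS](ext_hom_eq aO aO gh idh Z1) -[RHS](ext_hom_eq aO aO gh idh Z2) /=.
by congr f; apply/fibre_piP; rewrite /merge_points; case: pselect => //; case: pselect.
Qed.

End Merge.

Lemma two_remainder_points a : ~ end_tough G -> omega_compactification a ->
  exists x1 x2, [/\ x1 <> x2, remainder a x1 & remainder a x2].
Proof.
move=> ntG aO; apply: contrapT => h; apply: ntG.
apply: (small_remainder_end_tough aO) => x y nx ny; apply: contrapT => xy.
by apply: h; exists x, y.
Qed.

Lemma no_coarsest_omega : ~ end_tough G -> ~ exists a, coarsest (@omega_compactification R G) a.
Proof.
move=> ntG [a [aO /= amin]]; have [x1 [x2 [x12 r1 r2]]] := two_remainder_points ntG aO.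
exact/(merged_not_coarser aO x12 r1 r2)/amin/merged_omega.
Qed.

Lemma no_coarsest_crude : ~ end_tough G -> ~ exists a, coarsest (@crude_omega R G) a.
Proof.
move=> ntG [a [[aO ac] /= amin]]; have [x1 [x2 [x12 r1 r2]]] := two_remainder_points ntG aO.
apply/(merged_not_coarser aO x12 r1 r2)/amin; split; first exact: merged_omega.
exact: merged_crude.
Qed.

End LargeRemainder.

(** * The tangle compactification *)

Section ToughTangles.
Variables (R : realType) (G : graph).
Local Notation Y := (end_space R G).
Local Notation inner := (@inner_set R G).
Local Notation Y0 := (~` inner).
Implicit Types a b : extension Y.

Lemma tangle_space_subbase (S : set (tangle_space R G)) : @tangle_space_open R G S -> open S.
Proof.
move=> bS; exists [set S]; last by rewrite bigcup_set1.
by move=> _ ->; exact: (@finI_from1 _ _ (@tangle_space_open R G) id).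
Qed.

Lemma tangle_map_continuous : continuous (@tangle_map R G).
Proof.
apply/continuousP => W oW; rewrite openE => y Wy.
pose Q (S : set (tangle_space R G)) := nbhs y (@tangle_map R G @^-1` S).
apply: (@subbase_ind _ (@tangle_space_open R G) W (tangle_map y) Q oW Wy).
- exact: filterT.
- by move=> A B; exact: filterI.
- by move=> A B AB; apply: filterS => q /AB.
- move=> _ [[U oU ->] Sy|[X [Cs [finX CsX ->]]] Sy].
    apply: open_nbhs_nbhs; split=> //.
    rewrite (_ : _ @^-1` _ = inl @` U); first exact: open_inl.
    by apply/seteqP; split=> [[p|w] [q Uq] // [<-]|_ [q Uq <-]]; exists q.
  apply: open_nbhs_nbhs; split=> //; apply: end_space_subbase; right; exists X, Cs; split=> //.
  apply/seteqP; split=> [[p|w]|_ [[p pC <-]|[w wC <-]]].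
  + by move=> [[q qC [<-]]|[t _ //]]; left; exists q.
  + move=> [[q _ //]|[t tC [tE]]]; right; exists w => //=.
    by apply/(end_tangle_vertices_of _ finX CsX); move: tC; rewrite tE.
  + by left; exists p.
  + by right; exists (end_tangle w) => //; exact/(end_tangle_vertices_of _ finX CsX).
Qed.

Lemma tough_tangle_map_surj : tough G -> forall q, range (@tangle_map R G) q.
Proof.
move=> tG [p|t]; first by exists (inl p).
by have [w wt] := tough_tangle_end tG t; exists (inr w) => //=; rewrite wt.
Qed.

(** Every tangle is an end here, so a basic open set of tangles contains nothing beyond the image of
    the corresponding basic open set of ends. *)
Lemma tough_tangle_map_embedding : tough G -> embedding (@tangle_map R G).
Proof.
move=> tG; split.
- move=> [p|w] [q|w'] //= E; first by case: E => ->.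
  have ww : end_tangle w = end_tangle w' := inr_inj E.
  by rewrite (end_tangle_inj ww).
- exact: tangle_map_continuous.
- move=> U oU; exists (@tangle_map R G @` U); last first.
    by rewrite setIidl // => _ [y _ <-]; exists y.
  have [oG oE] := (open_end_space U).1 oU.
  apply: openP_sub => _ [[p|w] Uy <-].
    exists (inl @` (inl @^-1` U)); split.
    + by apply: tangle_space_subbase; left; exists (inl @^-1` U).
    + by exists p.
    + by move=> _ [q Uq <-]; exists (inl q).
  have [X finX XU] := oE w Uy; have cX := end_comp_component w finX.
  pose Cs := [set end_comp X w].
  have CsX : Cs `<=` components X by move=> _ ->.
  have VE : vertices_of Cs = end_comp X w by rewrite /vertices_of bigcup_set1.
  have CU : inl @` cone R X Cs `|` inr @` [set w | Cs (end_comp X w)] `<=` U.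
    by rewrite cone_crude_of // VE.
  exists (inl @` cone R X Cs `|` inr @` [set t : tangles G |
    sval t (~` vertices_of Cs, X `|` vertices_of Cs)]); split.
  + by apply: tangle_space_subbase; right; exists X, Cs.
  + by right; exists (end_tangle w) => //; apply/(end_tangle_vertices_of _ finX CsX).
  + move=> _ [[q qC <-]|[t tC <-]].
      by exists (inl q) => //; apply: CU; left; exists q.
    have [w' wt] := tough_tangle_end tG t; subst t.
    exists (inr w') => //; apply: CU; right; exists w' => //.
    exact/(end_tangle_vertices_of _ finX CsX).
Qed.

Lemma compact_end_space : tough G -> compact [set: Y].
Proof.
move=> tG; have idE : embedding (id : Y -> Y).
  split=> [x y //|x|U oU]; first exact: cvg_id.
  exists U => //; apply/seteqP; split=> [_ [y Uy <-]|y [Uy _]]; last by exists y.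
  by split=> //; exists y.
apply: (compact_of_skeleton idE); first by rewrite image_id; exact/compact_Y0.
move=> z zI W; rewrite {1}nbhsE => -[U [oU Uz] UW].
case: zI Uz => [nz|[w ->]] Uz; first by case: nz; exists z.
have [_ /(_ w Uz)[X finX XU]] := (open_end_space U).1 oU.
have cX := closed_off_component (end_comp_component w finX).
exists (crude_of (hull R (end_comp X w))).
  by apply: open_nbhs_nbhs; split; [exact: open_hull cX|exact: tails_in_end_comp].
by split=> [p /XU /UW //|v e t ve hv]; exists v.
Qed.

Lemma tough_omega b : tough G -> embedding (ext_map b) ->
  (forall q, range (ext_map b) q) -> omega_compactification b.
Proof.
move=> tG be surj; have [iI ic _] := be.
have ZE : skeleton b = ext_map b @` Y0.
  apply/seteqP; split=> [z Zz|_ [y Yy <-]]; last exact: skeleton_ext_map.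
  by have [y _ yz] := surj z; exists y => // yI; apply: Zz; exists y.
apply/omega_compactificationP; split=> //.
- rewrite (_ : setT = ext_map b @` setT); last by apply/seteqP; split.
  exact: (@compact_embedding _ _ (ext_map b) be setT (compact_end_space tG)).
- by rewrite ZE; apply: (@compact_embedding _ _ (ext_map b) be Y0); exact/compact_Y0.
- rewrite ZE => _ _ [x Yx <-] [y Yy <-] xy.
  have [|U [V [oU oV Ux Vy UV]]] := separated_end_space Yx Yy.
    by move=> E; apply: xy; rewrite E.
  have [U' [oU' UE]] := embedding_open be oU; have [V' [oV' VE]] := embedding_open be oV.
  exists U', V'; split=> //; [exact/UE|exact/VE|].
  apply/seteqP; split=> // p [[U'z V'z] [z Yz zE]]; subst p.
  by have : (U `&` V `&` Y0) z by [split=> //; split; [exact/UE|exact/VE]]; rewrite UV.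
- by rewrite ZE => W z _ Wz [y Yy yz]; subst z; exists y.
Qed.

Lemma tough_tangle_coarsest : tough G -> coarsest (@omega_compactification R G) (tangle_ext R G).
Proof.
move=> tG; split.
  exact: (@tough_omega (tangle_ext R G) tG (tough_tangle_map_embedding tG)
    (tough_tangle_map_surj tG)).
move=> b /(tough_homeomorphism tG)[_ [g [gc gK _]]].
exists (@tangle_map R G \o g); split.
  by move=> x; apply: continuous_comp; [exact: gc|exact: tangle_map_continuous].
by apply/funext => y /=; rewrite gK.
Qed.

(** The image of the skeleton of [b] is compact, hence closed in the Hausdorff skeleton of [a], and
    it contains the dense set of vertices and ends. *)
Lemma ext_hom_skeleton_surj a b (f : b -> a) z : omega_compactification a ->
  omega_compactification b -> ext_hom f -> skeleton a z -> exists2 x, skeleton b x & f x = z.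
Proof.
move=> aO bO fh Zz; have [fc fE] := fh.
have [_ _ _ sZ dZ] := (omega_compactificationP a).1 aO.
have [_ [iI _ _] cZ _ _] := (omega_compactificationP b).1 bO.
have cfZ : compact (f @` skeleton b).
  by apply: continuous_compact => //; exact: continuous_subspaceT.
apply: contrapT => nz.
have nfz : ~ (f @` skeleton b) z by move=> [x Zx xz]; apply: nz; exists x.
have [|W [oW Wz W0]] := compact_separate sZ cfZ _ Zz nfz.
  by move=> _ [x Zx <-]; exact: ext_hom_skeleton fh Zx.
have [y Yy Wy] := dZ W z oW Wz Zz.
have : (W `&` f @` skeleton b) (ext_map a y).
  split=> //; exists (ext_map b y); first exact: skeleton_ext_map.
  by rewrite -fE.
by rewrite W0.
Qed.

(** For [G] not tough but end-tough, the one-point compactification would map onto the skeleton of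
    the tangle space. Only [None] can hit a tangle that is no end, and there are at least two of
    these. *)
Lemma tangle_coarsest_tough : coarsest (@omega_compactification R G) (tangle_ext R G) -> tough G.
Proof.
move=> tC; apply: contrapT => ntG.
have [etG|netG] := pselect (end_tough G); last first.
  by apply: (no_coarsest_omega netG); exists (tangle_ext R G).
have [tO /= tmin] := tC; have aO := one_point_omega R ntG etG.
have [f fh] := tmin _ aO; have [_ fE] := fh.
have [t1 [t2 [t12 tn]]] := two_ultra_tangles ntG.
have fN t : (forall w, end_tangle w <> t) -> f None = inr t.
  move=> nt; have rt := tangle_remainder (R := R) nt.
  have [[y|] // _ fy] := ext_hom_skeleton_surj tO aO fh (remainder_skeleton rt).
  case: rt; exists y => //; rewrite -fy.
  by rewrite -[LHS](congr1 (fun h => h y) fE).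
have [n1 n2] : (forall w, end_tangle w <> t1) /\ (forall w, end_tangle w <> t2).
  by split=> w; case: (tn w).
by apply: t12; have := fN t1 n1; rewrite (fN t2 n2) => -[].
Qed.

End ToughTangles.

Theorem theorem3p12 (R : realType) (G : graph) :
  (tough G ->
     forall a : extension (end_space R G),
       omega_compactification a -> homeomorphism (ext_map a)) /\
  (~ tough G -> end_tough G ->
     exists a : extension (end_space R G),
       [/\ crude_omega a /\ one_point a,
           coarsest (@crude_omega R G) a,
           forall d : extension (end_space R G), crude_omega d ->
             forall f : d -> a, ext_hom f ->
               top_equivalent (quotient_ext f) a &
           ~ top_equivalent a (tangle_ext R G)]) /\
  (~ tough G -> ~ end_tough G ->
     [/\ ~ (exists a : extension (end_space R G),
              omega_compactification a /\
              forall x y : a, remainder a x -> remainder a y -> x = y),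
         ~ (exists a, coarsest (@omega_compactification R G) a) &
         ~ (exists a, coarsest (@crude_omega R G) a)]) /\
  (coarsest (@omega_compactification R G) (tangle_ext R G) <-> tough G).
Proof.
split=> [tG a aO|]; first exact: tough_homeomorphism.
split=> [ntG etG|].
  exists (one_point_ext R G); split.
  - split; last by exists None; exact: one_point_remainder.
    by split; [exact: one_point_omega|exact: one_point_crude].
  - exact: one_point_coarsest.
  - by move=> d dc f; exact: one_point_quotient.
  - exact: one_point_not_tangle.
split=> [ntG netG|]; last by split; [exact: tangle_coarsest_tough|exact: tough_tangle_coarsest].
split; [|exact: no_coarsest_omega|exact: no_coarsest_crude].
by move=> [a [aO rem1]]; apply: netG; exact: small_remainder_end_tough rem1.
Qed.
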